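(* Let $A$ be a finite set, $\Omega=A^{\mathbb{Z}}$ with Borel $\sigma$-algebra $\mathcal{F}$, $T$ the left shift, and $\mu\in\Delta(\Omega)$ stationary. Let $\mathcal{D}$ be a shift-invariant $\sigma$-algebra of Borel subsets of $\Omega$ with $\mathcal{D}\subseteq\mathcal{F}_{-\infty}^0$. Then the decomposition $(\Theta,\mathcal{B},\lambda,(\mu_\theta))$ of $\mu$ induced by $\mathcal{D}$ is weakly learnable: for $\lambda$-almost every $\theta$, for $\mu_\theta$-almost every $\omega=(\dots,a_{-1},a_0,a_1,\dots)$, $$\bigl\|\mu(\zeta_n=\cdot\mid \zeta_0=a_0,\dots,\zeta_{n-1}=a_{n-1})-\mu_\theta(\zeta_n=\cdot\mid \zeta_0=a_0,\dots,\zeta_{n-1}=a_{n-1})\bigr\|$$ strongly Cesaro converges to $0$ as $n\to\infty$.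
   Context: $\zeta_n:\Omega\to A$ is the $n$-th coordinate, $T(\omega)_n=\omega_{n+1}$. For $-\infty\le m<k\le\infty$, $\mathcal{F}_m^k$ is the $\sigma$-algebra generated by $\zeta_j$, $m\le j<k$; so $\mathcal{F}_{-\infty}^0$ is generated by $(\zeta_j)_{j<0}$. A $\sigma$-algebra $\mathcal{D}$ is shift-invariant if $S\in\mathcal{D}\iff T(S)\in\mathcal{D}$ for every Borel $S$. The decomposition induced by $\mathcal{D}$: let $(\Theta,\mathcal{B},\lambda)$ with measurable $\alpha:\Omega\to\Theta$ be the quotient of $(\Omega,\mathcal{F},\mu)$ by $\mathcal{D}$ (a standard probability space such that $\mathcal{D}$ is generated by $\alpha$ up to $\mu$-null sets, $\lambda=\alpha_*\mu$), and $(\mu_\theta)_{\theta\in\Theta}$ the conditional distributions of $\mu$ given $\mathcal{D}$: $\mu_\theta(\{\omega:\alpha(\omega)=\theta\})=1$, $\theta\mapsto\mu_\theta(S)$ is measurable, and $\mu(S)=\int\mu_\theta(S)\,\lambda(\mathrm d\theta)$ for all $S\in\mathcal{F}$. For $p,q\in\Delta(A)$, $\|p-q\|=\max_{a}|p[a]-q[a]|$. A bounded sequence $x_n$ strongly Cesaro converges to $x$ if $\frac1N\sum_{n<N}|x_n-x|\to0$. *)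

(* Defs.v *)
From HB Require Import structures.
From mathcomp Require Import all_boot all_order all_algebra.
From mathcomp Require Import all_classical all_reals all_analysis.
From mathcomp Require Import measurable_realfun.
From mathcomp Require Import finmap.
Set Implicit Arguments. Unset Strict Implicit. Unset Printing Implicit Defensive.
Import Order.TTheory GRing.Theory Num.Theory.
Import numFieldNormedType.Exports.
Local Open Scope classical_set_scope.
Local Open Scope ring_scope.

Section Shift.
Variable A : pointedType.

Definition zeta (n : int) (w : int -> A) : A := w n.

(* generators of the Borel (= product) sigma-algebra of A^Z, A finite discrete:
   the one-coordinate cylinders *)
Definition cyl_gens : set (set (int -> A)) :=
  [set S | exists (j : int) (a : A), S = zeta j @^-1` [set a]].

Definition Omega : Type := g_sigma_algebraType cyl_gens.

Definition Tshift (w : Omega) : Omega := fun n => w (n + 1).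

Definition past_sigma : set (set Omega) :=
  <<s [set S | exists (j : int) (a : A), j < 0 /\ S = zeta j @^-1` [set a]] >>.

Definition cyl (n : nat) (w : Omega) : set Omega :=
  [set w' | forall j : nat, (j < n)%N -> w' j%:Z = w j%:Z].

Definition symdiff (X Y : set Omega) : set Omega := (X `\` Y) `|` (Y `\` X).

Variable R : realType.

(* P(zeta_n = a | zeta_0 = w_0, ..., zeta_{n-1} = w_{n-1})
   (with the convention x / 0 = 0 of MathComp) *)
Definition cprob (P : set Omega -> \bar R) (n : nat) (a : A) (w : Omega) : R :=
  fine (P (cyl n w `&` [set w' | w' n%:Z = a])) / fine (P (cyl n w)).

Definition dist_diff (P Q : set Omega -> \bar R) (n : nat) (w : Omega) : R :=
  \big[Num.max/0]_(a <- (fset_set [set: A] : seq A)) `|cprob P n a w - cprob Q n a w|.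

End Shift.

Definition strong_cesaro0 (R : realType) (x : nat -> R) : Prop :=
  (fun N : nat => N%:R^-1 * \sum_(n < N) `|x n - 0|) @ \oo --> (0 : R).

(* standard Borel space: Borel-isomorphic to a Borel subset of R
   (measurable injection into R mapping measurable sets to Borel sets) *)
Definition standard_borel (R : realType) (d : measure_display)
  (Th : measurableType d) : Prop :=
  exists f : Th -> R, injective f /\ measurable_fun setT f /\
    (forall B : set Th, measurable B -> measurable (f @` B)).

(* Main.v *)
(* Fix a letter [a]. Let [X_j] be the indicator of [zeta_j = a], let [p_j] and
   [q_j] be its predictions under [mu] and under the fiber measure given
   [zeta_0, ..., zeta_(j-1)], and let [r] be the conditional probability of
   [zeta_0 = a] given the infinite past, [r_j = r o T^j]. For every predictor
   [s_j] that only looks at [zeta_0, ..., zeta_(j-1)],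
     (p_j - q_j)^2 <= (s_j - r_j)^2 - 2 (s_j - q_j) (X_j - r_j)
                      + 2 (p_j - q_j) (X_j - q_j) + 2 (s_j - p_j) (X_j - p_j).
   The last three terms are bounded martingale differences (the first of them
   because [D] lies in the past, so that [q_j] is a function of the past of time
   [j]), and their Cesaro means vanish almost surely: no more than pairwise
   orthogonality is needed, via Chebyshev along the squares. Taking
   [s_j = u o T^j] for a function [u] of finitely many past coordinates that is
   close to [r] in mean, the maximal ergodic lemma bounds the means of
   [(s_j - r_j)^2] uniformly in time. *)
Require Import Defs.
From HB Require Import structures.
From mathcomp Require Import finmap.
From mathcomp Require Import all_boot all_order all_algebra.
From mathcomp Require Import all_classical all_reals all_analysis.
From mathcomp Require Import measurable_realfun.
From mathcomp Require Import ring lra zify.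
Import Order.TTheory GRing.Theory Num.Theory.
Import numFieldNormedType.Exports.
Local Open Scope classical_set_scope.
Local Open Scope ring_scope.

(** * Expectations of bounded measurable functions *)

Section BoundedExpectation.
Context {d : measure_display} {T : measurableType d} {R : realType}.

(** The bound is everywhere and refers to no measure, so a single proof of [bmfun f] gives
    integrability under [mu] and under every fiber measure. *)
Definition bmfun (f : T -> R) : Prop :=
  measurable_fun setT f /\ exists c : R, forall x, `|f x| <= c.

Lemma bmfun_cst (c : R) : bmfun (fun=> c).
Proof. by split => //; exists `|c|. Qed.

Lemma bmfunD f g : bmfun f -> bmfun g -> bmfun (fun x => f x + g x).
Proof.
move=> [mf [c fc]] [mg [c' gc]]; split; first exact: measurable_funD.
by exists (c + c') => x; rewrite (le_trans (ler_normD _ _))// lerD.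
Qed.

Lemma bmfunM f g : bmfun f -> bmfun g -> bmfun (fun x => f x * g x).
Proof.
move=> [mf [c fc]] [mg [c' gc]]; split; first exact: measurable_funM.
by exists (c * c') => x; rewrite normrM ler_pM.
Qed.

Lemma bmfunB f g : bmfun f -> bmfun g -> bmfun (fun x => f x - g x).
Proof.
move=> [mf [c fc]] [mg [c' gc]]; split; first exact: measurable_funB.
by exists (c + c') => x; rewrite (le_trans (ler_normB _ _))// lerD.
Qed.

Lemma bmfun_norm f : bmfun f -> bmfun (fun x => `|f x|).
Proof.
move=> [mf [c fc]]; split; first exact: measurableT_comp.
by exists c => x; rewrite normr_id.
Qed.

Lemma bmfun_indic (S : set T) : measurable S -> bmfun \1_S.
Proof.
move=> mS; split; first exact: measurable_indic.
by exists 1 => x; rewrite indicE; case: (_ \in _); rewrite ?normr1 ?normr0.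
Qed.

Lemma bmfun_sum (I : Type) (s : seq I) (F : I -> T -> R) :
  (forall i, bmfun (F i)) -> bmfun (fun x => \sum_(i <- s) F i x).
Proof.
move=> bF; elim: s => [|i s ih].
  by under [X in bmfun X]eq_fun do rewrite big_nil; exact: bmfun_cst.
by under [X in bmfun X]eq_fun do rewrite big_cons; exact: bmfunD.
Qed.

Lemma bmfun01 (f : T -> R) : measurable_fun setT f ->
  (forall x, 0 <= f x <= 1) -> bmfun f.
Proof.
move=> mf f01; split => //; exists 1 => x.
by have /andP[f0 f1] := f01 x; rewrite ger0_norm.
Qed.

Variable P : probability T R.

Definition Ex (f : T -> R) : R := \int[P]_x f x.

Lemma bmfun_integrable f : bmfun f -> P.-integrable setT (EFin \o f).
Proof.
move=> [mf [c fc]]; apply: measurable_bounded_integrable => //.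
  exact: fin_num_fun_lty (fin_num_measure P).
exists c; split; first exact: num_real.
by move=> y cy x _; apply: le_trans (fc x) _; exact: ltW.
Qed.

Lemma ExD f g : bmfun f -> bmfun g -> Ex (fun x => f x + g x) = Ex f + Ex g.
Proof. by move=> bf bg; apply: RintegralD => //; exact: bmfun_integrable. Qed.

Lemma ExB f g : bmfun f -> bmfun g -> Ex (fun x => f x - g x) = Ex f - Ex g.
Proof. by move=> bf bg; apply: RintegralB => //; exact: bmfun_integrable. Qed.

Lemma ExZ (c : R) f : bmfun f -> Ex (fun x => c * f x) = c * Ex f.
Proof. by move=> bf; apply: RintegralZl => //; exact: bmfun_integrable. Qed.

Lemma Ex_cst (c : R) : Ex (fun=> c) = c.
Proof. by rewrite /Ex Rintegral_cst// [X in fine X]probability_setT mulr1. Qed.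

Lemma Ex_sum (I : Type) (s : seq I) (F : I -> T -> R) :
  (forall i, bmfun (F i)) ->
  Ex (fun x => \sum_(i <- s) F i x) = \sum_(i <- s) Ex (F i).
Proof.
move=> bF; elim: s => [|i s ih].
  by under [X in Ex X]eq_fun do rewrite big_nil; rewrite Ex_cst big_nil.
under [X in Ex X]eq_fun do rewrite big_cons.
by rewrite ExD ?ih ?big_cons//; exact: bmfun_sum.
Qed.

Lemma le_Ex f g : bmfun f -> bmfun g -> (forall x, f x <= g x) -> Ex f <= Ex g.
Proof.
by move=> bf bg fg; apply: le_Rintegral => //; exact: bmfun_integrable.
Qed.

Lemma Ex_indic (S : set T) : measurable S -> Ex \1_S = fine (P S).
Proof. by move=> mS; rewrite /Ex /Rintegral integral_indic// setIT. Qed.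

Lemma norm_Ex f : bmfun f -> `|Ex f| <= Ex (fun x => `|f x|).
Proof. by move=> bf; apply: le_normr_Rintegral => //; exact: bmfun_integrable. Qed.

(** Markov's inequality: [\1_S <= e^-1 * f] pointwise. *)
Lemma markov_indic f (S : set T) (e : R) : 0 < e -> measurable S -> bmfun f ->
  (forall x, 0 <= f x) -> (forall x, S x -> e <= f x) ->
  (P S <= (e^-1 * Ex f)%:E)%E.
Proof.
move=> e0 mS bf f0 Sf; rewrite -(fineK (fin_num_measure P _ mS)) lee_fin.
rewrite -Ex_indic// -ExZ//; apply: le_Ex.
- exact: bmfun_indic.
- by apply: bmfunM => //; exact: bmfun_cst.
move=> x; rewrite indicE; have [|_] := boolP (x \in S).
  by move/set_mem/Sf => ?; rewrite -ler_pdivrMl ?invr_gt0// invrK mulr1.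
by rewrite mulr_ge0// invr_ge0 ltW.
Qed.

End BoundedExpectation.

(** Change of variables. Here [phi] will be either a measure-preserving map or the identity from a
    space to itself with a smaller sigma-algebra. *)
Lemma Ex_comp d d' (T : measurableType d) (T' : measurableType d')
  (R : realType) (P : probability T R) (Q : probability T' R) (phi : T -> T') :
  measurable_fun setT phi ->
  (forall S, measurable S -> Q S = P (phi @^-1` S)) ->
  forall f, bmfun f -> Ex P (f \o phi) = Ex Q f.
Proof.
move=> mphi QP f bf; have [mf [c fc]] := bf.
rewrite /Ex /Rintegral; congr fine.
transitivity (\int[pushforward P phi]_y (f y)%:E)%E.
  rewrite integral_pushforward//=; first exact/measurable_EFinP.
  have : bmfun (f \o phi).
    by split; [exact: measurableT_comp|exists c => x; exact: fc].
  exact: bmfun_integrable.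
by apply: eq_measure_integral => A mA _; first [exact: QP | exact/esym/QP].
Qed.

(** * A strong law for bounded orthogonal sequences *)

Lemma cesaro_squares (R : realType) (Y : nat -> R) (c : R) :
  (forall j, `|Y j| <= c) ->
  (forall e : R, 0 < e ->
     \forall n \near \oo, `|\sum_(j < n ^ 2) Y j| <= e * n%:R ^+ 2) ->
  (fun N => N%:R^-1 * \sum_(j < N) Y j) @ \oo --> (0 : R).
Proof.
move=> Yc Ysq; apply/cvgr0Pnorm_le => e e0.
have c0 : 0 <= c := le_trans (normr_ge0 _) (Yc 0%N).
have e20 : 0 < e / 2 by lra.
have [M _ HM] := Ysq _ e20.
(* Between [n ^ 2] and [N < n.+1 ^ 2] there are at most [2 * n] terms, of total size at most
   [2 * c * n]; for [n >= K] this is at most [e / 2 * n ^ 2]. *)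
pose K := (Num.truncn (4 * c / e)).+1.
have HK n : (K <= n)%N -> 4 * c <= e * n%:R.
  move=> Kn; rewrite [leRHS]mulrC -ler_pdivrMr//.
  by rewrite (le_trans (ltW (truncnS_gt _)))// ler_nat.
(* This threshold forces the integer square root [n] of [N] above both [M] and [K]. *)
exists ((maxn M K).+1 ^ 2)%N => // N /= leN.
have [n [n1 n2]] : exists n, (n ^ 2 <= N)%N /\ (N < n.+1 ^ 2)%N.
  elim: {leN} N => [|N [n [n1 n2]]]; first by exists 0%N.
  by have [|] := leqP (n.+1 ^ 2) N.+1; [exists n.+1|exists n]; nia.
have [Mn Kn] : (M <= n /\ K <= n)%N by nia.
have N0 : (0 < N)%N by nia.
rewrite normrM ger0_norm ?invr_ge0// ler_pdivrMl ?ltr0n// mulrC.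
have -> : \sum_(j < N) Y j =
    \sum_(j < n ^ 2) Y j + \sum_(n ^ 2 <= j < N) Y j.
  by rewrite -(big_mkord predT Y) (@big_cat_nat _ _ _ (n ^ 2))//= big_mkord.
apply: (le_trans (ler_normD _ _)).
have h1 := HM n Mn; have h2 := HK n Kn.
have h3 : `|\sum_(n ^ 2 <= j < N) Y j| <= c * (2 * n%:R).
  apply: (le_trans (ler_norm_sum _ _ _)).
  apply: (@le_trans _ _ (\sum_(n ^ 2 <= j < N) c)); first exact: ler_sum.
  rewrite big_const_nat iter_addr_0 -[c *+ _]mulr_natr ler_wpM2l// -natrM ler_nat; nia.
have h4 : (n%:R : R) ^+ 2 <= N%:R by rewrite -natrX ler_nat.
have h5 : 0 <= (n%:R : R) by [].
nra.
Qed.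

(** The term [- N%:R^-1] carries the induction, since [1 / (x + 1) ^ 2 <= 1 / x - 1 / (x + 1)]; at
    [N = 0] it is 0 by convention. *)
Lemma sum_inv_sqr_le (R : realFieldType) N :
  \sum_(0 <= n < N) ((n.+1%:R : R) ^+ 2)^-1 <= 2 - N%:R^-1.
Proof.
elim: N => [|N ih]; first by rewrite big_nil invr0; lra.
rewrite big_nat_recr//=.
have [->|N0] := posnP N; first by rewrite big_nil !expr1n !invr1; lra.
apply: (le_trans (lerD ih (lexx _))).
set x : R := N%:R; have x0 : 0 < x by rewrite ltr0n.
rewrite -[N.+1%:R]natr1 -/x -subr_ge0.
have -> : 2 - (x + 1)^-1 - (2 - x^-1 + ((x + 1) ^+ 2)^-1) =
   x^-1 * ((x + 1) ^+ 2)^-1 by field; rewrite !gt_eqF//; lra.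
by rewrite mulr_ge0 ?invr_ge0 ?sqr_ge0// ltW.
Qed.

Section Orthogonal.
Context {d : measure_display} {T : measurableType d} {R : realType}.
Variable P : probability T R.
Variables (Y : nat -> T -> R) (c : R).
Hypothesis mY : forall j, measurable_fun setT (Y j).
Hypothesis Yc : forall j x, `|Y j x| <= c.
Hypothesis Yorth : forall i j, (i < j)%N -> Ex P (fun x => Y i x * Y j x) = 0.

Let bmY j : bmfun (Y j). Proof. by split => //; exists c. Qed.

(** Pythagoras by induction: the cross terms with the last summand have mean zero. *)
Lemma second_moment_orthogonal n :
  Ex P (fun x => (\sum_(j < n) Y j x) ^+ 2) <= n%:R * c ^+ 2.
Proof.
elim: n => [|n ih].
  under eq_fun do rewrite big_ord0 expr0n/=.
  by rewrite Ex_cst mul0r.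
pose S x := \sum_(j < n) Y j x.
have bS : bmfun S by apply: bmfun_sum => i.
have -> : (fun x => (\sum_(j < n.+1) Y j x) ^+ 2) =
  fun x => S x ^+ 2 + (2 * (\sum_(j < n) Y j x * Y n x) + Y n x * Y n x).
  apply/funext => x; rewrite big_ord_recr/= -mulr_suml -/(S x); ring.
have b1 : bmfun (fun x => S x ^+ 2) by exact: bmfunM.
have b2 : bmfun (fun x => \sum_(j < n) Y j x * Y n x).
  by apply: (bmfun_sum _ _ (fun (j : 'I_n) x => Y j x * Y n x)) => i; exact: bmfunM.
have b3 : bmfun (fun x => Y n x * Y n x) by exact: bmfunM.
have b4 : bmfun (fun x => 2 * (\sum_(j < n) Y j x * Y n x)).
  by apply: bmfunM => //; exact: bmfun_cst.
rewrite ExD//; last exact: bmfunD.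
rewrite ExD// ExZ// (Ex_sum P _ _ (fun (j : 'I_n) x => Y j x * Y n x)); last first.
  by move=> i; exact: bmfunM.
rewrite big1 ?mulr0 ?add0r; last by move=> i _; exact: Yorth.
rewrite -natr1 mulrDl mul1r lerD//.
rewrite -[leRHS](Ex_cst P); apply: le_Ex => //; first exact: bmfun_cst.
move=> x; rewrite -expr2 -real_normK ?num_real//.
by rewrite lerXn2r ?nnegrE ?normr_ge0// (le_trans _ (Yc n x)).
Qed.

(** The variance bound makes large deviations of the sums along squares summable, Borel-Cantelli
    excludes them eventually, and [cesaro_squares] fills the gaps between squares. *)
Lemma slln_orthogonal :
  {ae P, forall x, (fun N => N%:R^-1 * \sum_(j < N) Y j x) @ \oo --> (0 : R)}.
Proof.
pose S n x := \sum_(j < n) Y j x.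
have bS n : bmfun (S n) by apply: bmfun_sum => i.
(* Deviation events of the sums of [n.+1 ^ 2] terms. The thresholds [l.+1%:R^-1] are countable, so
   the exceptional null sets can be united. *)
pose A l n := [set x | l.+1%:R^-1 * n.+1%:R ^+ 2 <= `|S (n.+1 ^ 2)%N x|].
have mA l n : measurable (A l n).
  rewrite -[X in measurable X]setTI.
  by apply: measurable_fun_le => //; exact: (bmfun_norm _ (bS _)).1.
have PA l n : (P (A l n) <= (l.+1%:R ^+ 2 * c ^+ 2 / n.+1%:R ^+ 2)%:E)%E.
  apply: le_trans (markov_indic P (fun x => S (n.+1 ^ 2)%N x ^+ 2) (A l n)
    ((l.+1%:R^-1 * n.+1%:R ^+ 2) ^+ 2) _ _ _ _ _) _.
  - by rewrite exprn_gt0// mulr_gt0 ?exprn_gt0 ?invr_gt0 ?ltr0n.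
  - exact: mA.
  - exact: bmfunM.
  - by move=> x; exact: sqr_ge0.
  - move=> x Ax; rewrite -[leRHS]real_normK ?num_real// lerXn2r//.
    by rewrite nnegrE mulr_ge0 ?exprn_ge0 ?invr_ge0.
  - rewrite lee_fin -ler_pdivlMl ?invr_gt0 ?exprn_gt0 ?mulr_gt0 ?invr_gt0 ?exprn_gt0 ?ltr0n//.
    rewrite invrK; apply: (le_trans (second_moment_orthogonal _)).
    rewrite natrX le_eqVlt; apply/orP; left; apply/eqP.
    have : (l.+1%:R : R) != 0 by rewrite pnatr_eq0.
    have : (n.+1%:R : R) != 0 by rewrite pnatr_eq0.
    move: (l.+1%:R : R) (n.+1%:R : R) => a b b0 a0.
    by field; rewrite ?a0 ?b0.
have null l : P (lim_sup_set (A l)) = 0.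
  apply: lim_sup_set_cvg0 => //.
  apply: (@le_lt_trans _ _ (l.+1%:R ^+ 2 * c ^+ 2 * 2)%:E); last exact: ltry.
  apply: lime_le; first exact: is_cvg_nneseries.
  apply: nearW => N.
  apply: (@le_trans _ _ (\sum_(0 <= n < N) (l.+1%:R ^+ 2 * c ^+ 2 / n.+1%:R ^+ 2)%:E)%E).
    by apply: lee_sum => n _; exact: PA.
  rewrite sumEFin lee_fin -mulr_sumr ler_wpM2l ?(mulr_ge0 (sqr_ge0 _) (sqr_ge0 _))//.
  by apply: (le_trans (sum_inv_sqr_le _ _)); rewrite gerBl invr_ge0.
rewrite /almost_everywhere; have : P.-negligible (\bigcup_l lim_sup_set (A l)).
  apply: negligible_bigcup => l; apply/negligibleP; last exact: null.
  by apply: bigcap_measurable => // k _; exact: bigcup_measurable.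
apply: negligibleS => x /= ncvg.
apply: contrapT => nx; apply: ncvg.
apply: (@cesaro_squares R (fun j => Y j x) c) => // e e0.
pose l := Num.truncn e^-1.
have le : l.+1%:R^-1 <= e.
  by rewrite invf_ple ?posrE// ?ltr0n// ltW// truncnS_gt.
have /existsNP[n /not_implyP[_ nA]] : ~ lim_sup_set (A l) x.
  by move=> ?; apply: nx; exists l.
exists n.+1 => // m /= nm.
have [m' mE] : exists m', m = m'.+1 by exists m.-1; lia.
apply: (@le_trans _ _ (l.+1%:R^-1 * m%:R ^+ 2)).
  rewrite leNgt; apply/negP => h; apply: nA; exists m' => /=; first lia.
  by rewrite /A /= -mE ltW.
by rewrite ler_wpM2r ?sqr_ge0.
Qed.

End Orthogonal.

(** * The maximal ergodic lemma and its consequence for small means *)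

Section MaximalErgodic.
Context {d : measure_display} {T : measurableType d} {R : realType}.
Variables (P : probability T R) (f : T -> T).
Hypothesis mf : measurable_fun setT f.
Hypothesis Pf : forall S, measurable S -> P (f @^-1` S) = P S.

(** The maximum over [0 <= j <= n] of the sums of [g] along the first [j] points of the orbit, the
    empty sum included. *)
Fixpoint max_sums (g : T -> R) (n : nat) (x : T) : R :=
  if n is n'.+1 then Num.max 0 (g x + max_sums g n' (f x)) else 0.

Lemma max_sums_ge0 g n x : 0 <= max_sums g n x.
Proof. by case: n => //= n; rewrite le_max lexx. Qed.

Lemma max_sumsS g n x : max_sums g n x <= max_sums g n.+1 x.
Proof.
elim: n x => [|n ih] x; first exact: max_sums_ge0.
by rewrite [leLHS]/= [leRHS]/= ge_max !le_max lexx/= lerD2l ih orbT.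
Qed.

Lemma sum_le_max_sums g n x :
  \sum_(j < n) g (iter j f x) <= max_sums g n x.
Proof.
elim: n x => [|n ih] x; first by rewrite big_ord0.
rewrite big_ord_recl [leRHS]/= le_max; apply/orP; right; rewrite lerD//.
by under eq_bigr do rewrite lift0 iterSr; exact: ih.
Qed.

Lemma bmfun_max_sums g n : bmfun g -> bmfun (max_sums g n).
Proof.
move=> bg; elim: n => [|n [mM [c Mc]]]; first exact: bmfun_cst.
have [mg [c' gc]] := bg; split => /=.
  apply: measurable_maxr => //; apply: measurable_funD => //.
  exact: measurableT_comp.
exists (c' + c) => x; rewrite ger0_norm ?le_max ?lexx//.
have c0 : 0 <= c := le_trans (normr_ge0 _) (Mc x).
have c'0 : 0 <= c' := le_trans (normr_ge0 _) (gc x).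
rewrite ge_max addr_ge0//= lerD//; exact: le_trans (ler_norm _) _.
Qed.

(* Garsia's argument: on [0 < max_sums] one has
   [max_sums g n <= g + max_sums g n \o f]. *)
Lemma maximal_ergodic (phi : T -> R) (e : R) : 0 < e ->
  bmfun phi -> (forall x, 0 <= phi x) ->
  exists B, [/\ measurable B, (P B <= (e^-1 * Ex P phi)%:E)%E &
    forall x, ~ B x -> forall n, \sum_(j < n) phi (iter j f x) <= n%:R * e].
Proof.
move=> e0 bphi phi0; pose g x := phi x - e.
have bg : bmfun g by apply: bmfunB => //; exact: bmfun_cst.
pose E n := [set x | 0 < max_sums g n x].
have mE n : measurable (E n).
  have -> : E n = ~` ([set: T] `&` [set x | max_sums g n x <= 0]).
    by rewrite setTI; apply/funext => x; apply/propext; rewrite /E/= ltNge; split => /negP.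
  apply: measurableC; apply: measurable_fun_le => //.
  by have [] := bmfun_max_sums g n bg.
have PE n : (P (E n) <= (e^-1 * Ex P phi)%:E)%E.
  have bM := bmfun_max_sums g n bg.
  have bMf : bmfun (max_sums g n \o f).
    have [mM [c Mc]] := bM; split; first exact: measurableT_comp.
    by exists c => x; exact: Mc.
  have b1 := bmfun_indic (E n) (mE n) : bmfun (\1_(E n) : T -> R).
  have ME x : max_sums g n x - max_sums g n (f x) <= \1_(E n) x * g x.
    rewrite indicE; case: (boolP (x \in E n)) => [|/negP nE].
      rewrite inE mul1r /E/=; case: n {mE bM bMf b1} => /= [|n]; first by rewrite ltxx.
      rewrite lt_max ltxx/= => h; rewrite (max_r (ltW h)) lerBlDr lerD2l.
      exact: (max_sumsS g n (f x)).
    rewrite mul0r subr_le0 (@le_trans _ _ 0) ?max_sums_ge0// leNgt.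
    by apply/negP => h; apply: nE; rewrite inE.
  (* By invariance of [P] the left side of [ME] has mean zero. *)
  have : 0 <= Ex P (fun x => \1_(E n) x * g x).
    apply: le_trans (le_Ex P _ _ _ _ ME); last 2 first.
    - by apply: bmfunB.
    - exact: bmfunM.
    by rewrite ExB// (Ex_comp _ _ _ _ _ P P f)// ?subrr// => S mS; rewrite Pf.
  have -> : (fun x => \1_(E n) x * g x) =
      (fun x => \1_(E n) x * phi x - e * \1_(E n) x).
    by apply/funext => x; rewrite /g; ring.
  have b2 : bmfun (fun x => \1_(E n) x * phi x) by exact: bmfunM.
  rewrite ExB//; last by apply: bmfunM => //; exact: bmfun_cst.
  rewrite ExZ// Ex_indic// subr_ge0 => h.
  rewrite -(fineK (fin_num_measure P _ (mE n))) lee_fin -ler_pdivrMl ?invr_gt0//.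
  rewrite invrK (le_trans h)//; apply: le_Ex => // x.
  by rewrite indicE; case: (_ \in _); rewrite ?mul1r ?mul0r.
(* The sets [E n] increase, so their union inherits the bound; off the union no partial sum of
   [phi - e] is positive. *)
exists (\bigcup_n E n); split; first exact: bigcup_measurable.
  have ndE : nondecreasing_seq E.
    apply/nondecreasing_seqP => n; apply/subsetPset => x; rewrite /E/= => h.
    exact: lt_le_trans h (max_sumsS g n x).
  have cv := @nondecreasing_cvg_mu _ _ _ P _ mE (bigcup_measurable (fun k _ => mE k)) ndE.
  rewrite -(cvg_lim _ cv)//; apply: lime_le; first by apply/cvg_ex; eexists; exact: cv.
  exact: nearW.
move=> x nx n.
have := sum_le_max_sums g n x; rewrite /g sumrB sumr_const card_ord.
have -> : max_sums g n x = 0.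
  apply/eqP; rewrite eq_le max_sums_ge0 andbT leNgt; apply/negP => h.
  by apply: nx; exists n.
by rewrite subr_le0 mulr_natl.
Qed.

(** At level [l.+1%:R^-1] the bad set of [phi m] has probability at most [l.+1%:R / m.+1%:R]. A
    point that is bad for every [m] lies in the intersection of these sets, which is null. *)
Lemma ae_small_averages (phi : nat -> T -> R) :
  (forall m, bmfun (phi m)) -> (forall m x, 0 <= phi m x) ->
  (forall m, Ex P (phi m) <= m.+1%:R^-1) ->
  {ae P, forall x, forall e : R, 0 < e -> exists m, forall n,
    \sum_(j < n) phi m (iter j f x) <= n%:R * e}.
Proof.
move=> bphi phi0 Ephi.
have Hl l : exists B, [/\ measurable B, P B = 0%E & forall x, ~ B x ->
    exists m, forall n, \sum_(j < n) phi m (iter j f x) <= n%:R * l.+1%:R^-1].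
  have l0 : 0 < l.+1%:R^-1 :> R by rewrite invr_gt0.
  have /choice[B HB] := fun m =>
    maximal_ergodic (phi m) l.+1%:R^-1 l0 (bphi m) (phi0 m).
  have mB : measurable (\bigcap_m B m).
    by apply: bigcap_measurable => // m _; have [] := HB m.
  exists (\bigcap_m B m); split => //.
    have PB m : fine (P (\bigcap_m B m)) <= l.+1%:R * m.+1%:R^-1.
      rewrite -lee_fin fineK ?fin_num_measure//.
      have [mBm PBm _] := HB m.
      apply: (@le_trans _ _ (P (B m))).
        by apply: le_measure; rewrite ?inE//; exact: bigcap_inf.
      apply: (le_trans PBm); rewrite lee_fin invrK ler_wpM2l//.
    apply/eqP; rewrite -(fineK (fin_num_measure P _ mB)) eqe.
    rewrite eq_le fine_ge0// andbT leNgt; apply/negP => h.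
    (* For this [m] the bound [l.+1%:R / m.+1%:R] falls strictly below the supposedly positive
       probability. *)
    have := PB (Num.truncn (l.+1%:R / fine (P (\bigcap_m B m)))).
    rewrite leNgt => /negP; apply.
    by rewrite ltr_pdivrMr// -ltr_pdivrMl// mulrC truncnS_gt.
  move=> x /existsNP[m /not_implyP[_ nB]]; exists m => n.
  by have [_ _] := HB m; apply.
have /choice[B HB] := Hl.
rewrite /almost_everywhere; have : P.-negligible (\bigcup_l B l).
  by apply: negligible_bigcup => l; apply/negligibleP; have [] := HB l.
apply: negligibleS => x /= nP; apply: contrapT => nB; apply: nP => e e0.
have [_ _ /(_ x)] := HB (Num.truncn e^-1).
case=> [h|m Hm]; first by apply: nB; exists (Num.truncn e^-1).
exists m => n; apply: (le_trans (Hm n)); rewrite ler_wpM2l//.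
by rewrite invf_ple ?posrE// ltW// truncnS_gt.
Qed.

End MaximalErgodic.

(** * Staircase approximation by superlevel sets *)

Section LevelSets.
Context {T : Type} {R : realType}.

Lemma sum_ltn_ord (M t : nat) : (t <= M)%N ->
  \sum_(i < M) ((i < t)%N%:R : R) = t%:R.
Proof.
move=> tM; rewrite -(subnKC tM) big_split_ord/= [X in _ + X]big1 ?addr0.
  under eq_bigr do rewrite ltn_ord.
  by rewrite sumr_const card_ord.
by move=> i _; rewrite ltnNge leq_addr.
Qed.

(** For [f] with values in [0, 1] this is [f] rounded down to a multiple of [1 / M]. As a
    combination of indicators of superlevel sets, it carries statements about sets over to
    functions. *)
Definition level_sum (f : T -> R) (M : nat) (x : T) : R :=
  M%:R^-1 * \sum_(i < M) \1_[set y | i.+1%:R <= M%:R * f y] x.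

Lemma level_sum_approx f M x : (0 < M)%N -> 0 <= f x <= 1 ->
  `|f x - level_sum f M x| <= M%:R^-1.
Proof.
move=> M0 /andP[f0 f1]; rewrite /level_sum.
have M0' : 0 < M%:R :> R by rewrite ltr0n.
pose t := Num.truncn (M%:R * f x).
have Mf0 : 0 <= M%:R * f x by rewrite mulr_ge0.
have tM : (t <= M)%N.
  rewrite -(ler_nat R); apply: (@le_trans _ _ (M%:R * f x)).
    by rewrite truncn_le.
  by rewrite -[leRHS]mulr1 ler_wpM2l// ltW.
have -> : \sum_(i < M) (\1_[set y | i.+1%:R <= M%:R * f y] x : R) = t%:R.
  rewrite -(sum_ltn_ord _ _ tM); apply: eq_bigr => i _.
  by rewrite indicE truncn_gt_nat mem_setE.
have /andP[h1 h2] : t%:R <= M%:R * f x < t.+1%:R by exact: truncn_itv.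
rewrite -[f x](@mulKf _ M%:R) ?gt_eqF// -mulrBr normrM ger0_norm ?invr_ge0//.
rewrite ler_piMr ?invr_ge0//.
move: h2; rewrite -natr1 => h2; rewrite ger0_norm; lra.
Qed.

End LevelSets.

(** * Conditional probability given a sub-sigma-algebra *)

Section SubSigma.
Context {d : measure_display} {T : measurableType d} {R : realType}.
Variables (P : probability T R) (G : set (set T)).
Hypothesis sG : sigma_algebra setT G.
Hypothesis Gm : G `<=` measurable.

Local Notation TG := (g_sigma_algebraType G).

(** Measurability with respect to [G]: the domain gets the sigma-algebra generated by [G], which is
    [G] itself by [sub_measurableE]. *)
Definition submeasurable_fun {d'} {U : measurableType d'} (f : T -> U) : Prop :=
  measurable_fun [set: TG] f.

Lemma sub_measurableE : (measurable : set (set TG)) = G.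
Proof. exact: measurable_g_measurableTypeE. Qed.

Lemma measurable_sub (S : set T) : measurable (S : set TG) -> measurable S.
Proof. by rewrite sub_measurableE => /Gm. Qed.

Lemma measurable_id_sub : measurable_fun setT (id : T -> TG).
Proof. by move=> _ S mS; rewrite setTI; exact: measurable_sub. Qed.

Lemma submeasurable_funW d' (U : measurableType d') (f : T -> U) :
  submeasurable_fun f -> measurable_fun setT f.
Proof. by move=> mf; exact: (measurableT_comp mf measurable_id_sub). Qed.

(** The restriction of [P] to [G], made a measure on [TG] so that the Radon-Nikodym theorem applies
    over [G]. *)
Let PG (S : set TG) : \bar R := P S.
Let PG0 : PG set0 = 0%E. Proof. exact: measure0. Qed.
Let PG_ge0 S : (0 <= PG S)%E. Proof. exact: measure_ge0. Qed.
Let PG_add : semi_sigma_additive PG.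
Proof.
move=> F mF tF mUF; apply: measure_semi_sigma_additive => //.
  by move=> i; exact: measurable_sub.
exact: measurable_sub.
Qed.
HB.instance Definition _ := isMeasure.Build _ TG R PG PG0 PG_ge0 PG_add.
Let PG_setT : PG setT = 1%E. Proof. exact: probability_setT. Qed.
HB.instance Definition _ := Measure_isProbability.Build _ TG R PG PG_setT.

Section CondProb.
Variables (B : set T) (mB : measurable B).

Let nuG (S : set TG) : \bar R := P (S `&` B).
Let nuG0 : nuG set0 = 0%E. Proof. by rewrite /nuG set0I measure0. Qed.
Let nuG_ge0 S : (0 <= nuG S)%E. Proof. exact: measure_ge0. Qed.
Let nuG_add : semi_sigma_additive nuG.
Proof.
move=> F mF tF mUF; rewrite /nuG setI_bigcupl.
apply: measure_semi_sigma_additive => //.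
- by move=> i; apply: measurableI => //; exact: measurable_sub.
- exact: trivIset_setIr.
- by rewrite -setI_bigcupl; apply: measurableI => //; exact: measurable_sub.
Qed.
HB.instance Definition _ := isMeasure.Build _ TG R nuG nuG0 nuG_ge0 nuG_add.
Let nuG_fin : fin_num_fun nuG.
Proof.
move=> S mS; apply: fin_num_measure; apply: measurableI => //.
exact: measurable_sub.
Qed.
HB.instance Definition _ := Measure_isFinite.Build _ TG R nuG nuG_fin.

(** [r] is the density of [nuG] with respect to [PG], cut off at 1 so that it lies in [0, 1]
    everywhere and not just almost everywhere. *)
Lemma cond_prob_sets : exists r : T -> R, [/\ submeasurable_fun r,
  (forall x, 0 <= r x <= 1) &
  forall S, G S -> Ex P (fun x => \1_S x * (\1_B x - r x)) = 0].
Proof.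
have nuP : nuG `<< PG.
  apply/null_content_dominatesP => S mS PS.
  apply/eqP; rewrite -measure_le0 -[leRHS]PS; apply: le_measure; rewrite ?inE//.
  - by apply: measurableI => //; exact: measurable_sub.
  - exact: measurable_sub.
have [f [f0 fint fE]] := radon_nikodym_finite nuP.
have mf : measurable_fun [set: TG] f := measurable_int _ fint.
pose r (x : T) : R := Num.min 1 (fine (f x)).
have mr : submeasurable_fun r.
  apply: measurable_minr => //.
  by apply: measurableT_comp.
have r01 x : 0 <= r x <= 1.
  by rewrite /r le_min ler01 fine_ge0//= ge_min lexx.
(* The cut-off changes only a null set: if [f >= 1 + q] on [S] with [q > 0], then
   [(1 + q) * PG S <= nuG S <= PG S], so [PG S = 0]. *)
have fr : ae_eq PG setT f (EFin \o r).
  pose A n := [set x : TG | (1 + n.+1%:R^-1)%:E <= f x]%E.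
  have mA n : measurable (A n).
    by rewrite -[X in measurable X]setTI; exact: emeasurable_fun_c_infty.
  have PA n : PG (A n) = 0%E.
    have : ((1 + n.+1%:R^-1)%:E * PG (A n) <= PG (A n))%E.
      apply: (@le_trans _ _ (nuG (A n))); last first.
        apply: le_measure; rewrite ?inE//; [apply: measurableI => //|]; exact: measurable_sub.
      rewrite fE// -integral_cst//; apply: ge0_le_integral => //.
        by move=> x _; rewrite lee_fin addr_ge0.
      exact: measurable_funTS.
    rewrite -(fineK (fin_num_measure PG _ (mA n))).
    have := fine_ge0 (measure_ge0 PG (A n)).
    set p := fine _ => p0; rewrite -EFinM lee_fin => h.
    congr EFin; apply/eqP; rewrite eq_le p0 andbT leNgt; apply/negP => p1.
    have : 0 < n.+1%:R^-1 :> R by rewrite invr_gt0.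
    move: (n.+1%:R^-1 : R) h => q; clearbody p; rewrite mulrDl mul1r => h n0.
    have := mulr_gt0 n0 p1; by move: h; rewrite gerDl leNgt => /negbTE ->.
  have : PG.-negligible (\bigcup_n A n).
    by apply: negligible_bigcup => n; exact/negligibleP.
  rewrite /ae_eq /almost_everywhere; apply: negligibleS => x /= /not_implyP[_ fx].
  have [x1|x1] := leP (f x) 1%E.
    case: fx; rewrite /r; have := f0 x; case: (f x) x1 => // p p1 p0/=.
    by rewrite min_r.
  apply: contrapT => nA; have [p fxE p1] : exists2 p, f x = p%:E & 1 < p.
    case fxE : (f x) (f0 x) x1 => [p| |] // _ p1; first by exists p.
    by exfalso; apply: nA; exists 0%N => //; rewrite /A/= fxE leey.
  apply: nA; exists (Num.truncn (p - 1)^-1) => //; rewrite /A/= fxE lee_fin -lerBrDl.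
  by rewrite invf_ple ?posrE ?subr_gt0// ltW// truncnS_gt.
exists r; split => // S GS.
have mS : measurable S by exact: Gm.
have mS' : measurable (S : set TG) by rewrite sub_measurableE.
have br : bmfun r by apply: bmfun01 => //; exact: submeasurable_funW.
have bS : bmfun (\1_S : T -> R) by exact: bmfun_indic.
have -> : (fun x => \1_S x * (\1_B x - r x)) =
    (fun x => \1_(S `&` B) x - \1_S x * r x).
  by apply/funext => x; rewrite indicI mulrBr.
have mSB : measurable (S `&` B) by exact: measurableI.
rewrite (ExB P) ?Ex_indic//; [|exact: bmfun_indic|exact: bmfunM].
rewrite -/(nuG S) fE//.
have mid : measurable_fun setT (id : T -> TG) by exact: measurable_id_sub.
have PGE S' : measurable S' -> PG S' = P ((id : T -> TG) @^-1` S') by [].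
have bSr : bmfun ((fun x => \1_S x * r x) : TG -> R).
  apply: bmfunM; first exact: bmfun_indic.
  exact: bmfun01.
rewrite (_ : Ex P _ = Ex PG (fun x => \1_S x * r x)); last first.
  exact: (Ex_comp _ _ _ _ _ P PG (id : T -> TG)).
rewrite /Ex /Rintegral (_ : (\int[PG]_(x in S) f x = \int[PG]_x (\1_S x * r x)%:E)%E) ?subrr//.
have frS : ae_eq PG S f (EFin \o r) by apply: filterS fr => x h _; exact: h.
rewrite (ge0_ae_eq_integral _ _ _ _ _ frS)//; last 3 first.
- exact: measurable_funTS.
- by apply/measurable_EFinP; exact: measurable_funTS.
- by move=> x _; rewrite lee_fin; case/andP: (r01 x).
rewrite integral_mkcond; apply: eq_integral => x _.
by rewrite patchE indicE; case: (x \in S); rewrite ?mul1r ?mul0r.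
Qed.

End CondProb.

Lemma submeasurable_level (f : T -> R) (y : R) :
  submeasurable_fun f -> G [set x | y <= f x].
Proof.
move=> mf; rewrite -sub_measurableE -[X in measurable X]setTI.
exact: measurable_fun_le.
Qed.

Lemma Ex_level_sum_approx (f : T -> R) M : (0 < M)%N ->
  bmfun f -> (forall x, 0 <= f x <= 1) ->
  bmfun (level_sum f M) /\ Ex P (fun x => `|f x - level_sum f M x|) <= M%:R^-1.
Proof.
move=> M0 bf f01.
have bl : bmfun (level_sum f M).
  apply: bmfunM; first exact: bmfun_cst.
  apply: (bmfun_sum _ _ (fun (i : 'I_M) => \1_[set y | i.+1%:R <= M%:R * f y])).
  move=> i; apply: bmfun_indic; rewrite -[X in measurable X]setTI.
  apply: measurable_fun_le => //; apply: measurable_funM => //; exact: bf.1.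
split => //; rewrite -[leRHS](Ex_cst P); apply: le_Ex.
- by apply: bmfun_norm; exact: bmfunB.
- exact: bmfun_cst.
- by move=> x; exact: level_sum_approx.
Qed.

(** From sets to bounded functions: [level_sum g M] combines indicators of sets in [G] and is
    uniformly within [1 / M] of [g], while [\1_B - r] is bounded by 1. *)
Lemma cond_prob (B : set T) : measurable B ->
  exists r : T -> R, [/\ submeasurable_fun r,
  (forall x, 0 <= r x <= 1) &
  forall g : T -> R, submeasurable_fun g -> (exists c, forall x, `|g x| <= c) ->
    Ex P (fun x => g x * (\1_B x - r x)) = 0].
Proof.
move=> mB; have [r [mr r01 rE]] := cond_prob_sets B mB.
exists r; split => // g mg.
have br : bmfun r by apply: bmfun01 => //; exact: submeasurable_funW.
have bB : bmfun (\1_B : T -> R) by exact: bmfun_indic.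
have bBr : bmfun (fun x => \1_B x - r x : R) by exact: bmfunB.
have Br1 x : `|\1_B x - r x| <= 1.
  have /andP[r0 r1] := r01 x.
  by rewrite ler_norml indicE; case: (_ \in _) => /=; apply/andP; split; lra.
(* A bounded [g] is [2 * c' * h - c'] with [h] in [0, 1]; the special case is applied to [h] and to
   the constant 1. *)
wlog g01 : g mg / forall x, 0 <= g x <= 1.
  move=> W [c gc]; pose c' := `|c| + 1; have c'0 : 0 < c' by rewrite ltr_wpDl.
  have gc' x : `|g x| <= c'.
    by rewrite (le_trans (gc x))// (le_trans (ler_norm _))// lerDl.
  pose h x := (2 * c')^-1 * (g x + c').
  have mh : submeasurable_fun h.
    by apply: measurable_funM => //; exact: measurable_funD.
  have h01 x : 0 <= h x <= 1.
    have := gc' x; rewrite ler_norml => /andP[h1 h2].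
    rewrite /h mulr_ge0 ?invr_ge0 ?mulr_ge0//=; [|lra|lra].
    rewrite ler_pdivrMl ?mulr1; lra.
  have bh : bmfun h by apply: bmfun01 => //; exact: submeasurable_funW.
  have b1 : bmfun (fun x => h x * (\1_B x - r x)) by exact: bmfunM.
  have -> : (fun x => g x * (\1_B x - r x)) =
     (fun x => (2 * c') * (h x * (\1_B x - r x)) - c' * (1 * (\1_B x - r x))).
    by apply/funext => x; rewrite /h; field; rewrite gt_eqF.
  have b2 : bmfun (fun x => 1 * (\1_B x - r x)).
    by apply: bmfunM => //; exact: bmfun_cst.
  have bc c0 f : bmfun f -> bmfun (fun x => c0 * f x : R).
    by move=> ?; apply: bmfunM => //; exact: bmfun_cst.
  rewrite (ExB P); [|exact: bc|exact: bc].
  rewrite (ExZ P _ _ b1) (ExZ P _ _ b2) !W ?mulr0 ?subrr//.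
  - exact: measurable_cst.
  - by move=> x; rewrite ler01 lexx.
  - by exists 1 => x; rewrite normr1.
  - by exists 1 => x; case/andP: (h01 x) => *; rewrite ger0_norm.
move=> _; have bg : bmfun g by apply: bmfun01 => //; exact: submeasurable_funW.
apply/eqP; rewrite -normr_le0; apply/ler_addgt0Pr => e e0; rewrite add0r.
pose M := (Num.truncn e^-1).+1.
have Me : M%:R^-1 <= e by rewrite invf_ple ?posrE// ltW// truncnS_gt.
have M0 : (0 < M)%N by [].
have [bl lE] := Ex_level_sum_approx g M M0 bg g01.
have lr0 : Ex P (fun x => level_sum g M x * (\1_B x - r x)) = 0.
  pose S (i : 'I_M) := [set y | i.+1%:R <= M%:R * g y].
  have GS i : G (S i).
    by apply: submeasurable_level; apply: measurable_funM.
  have bi i : bmfun (fun x => \1_(S i) x * (\1_B x - r x)).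
    by apply: bmfunM => //; apply/bmfun_indic/Gm.
  have -> : (fun x => level_sum g M x * (\1_B x - r x)) =
      (fun x => M%:R^-1 * \sum_(i < M) (\1_(S i) x * (\1_B x - r x))).
    by apply/funext => x; rewrite -mulr_suml mulrA.
  rewrite ExZ; last exact: (bmfun_sum _ _ (fun i x => \1_(S i) x * (\1_B x - r x))).
  rewrite (Ex_sum P _ _ (fun i x => \1_(S i) x * (\1_B x - r x)))// big1 ?mulr0//.
  by move=> i _; exact: rE.
have -> : Ex P (fun x => g x * (\1_B x - r x)) =
    Ex P (fun x => (g x - level_sum g M x) * (\1_B x - r x)).
  under [in RHS]eq_fun do rewrite mulrBl.
  by rewrite ExB ?lr0 ?subr0//; exact: bmfunM.
have bgl : bmfun (fun x => g x - level_sum g M x) by exact: bmfunB.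
apply: (le_trans (norm_Ex P _ (bmfunM _ _ bgl bBr))).
apply: le_trans (le_trans lE Me); apply: le_Ex.
- by apply: bmfun_norm; exact: bmfunM.
- exact: bmfun_norm.
- by move=> x; rewrite normrM ler_piMr.
Qed.

End SubSigma.

(** * Cylinders and the two-sided shift *)

Section Coordinates.
Context {A : pointedType}.
Local Notation Om := (Omega A).

Definition coord_eq (z : int) (a : A) : set Om := [set w | w z = a].

Lemma measurable_coord_eq z a : measurable (coord_eq z a).
Proof. by apply: sub_sigma_algebra; exists z, a. Qed.

Lemma measurable_cyl n (w : Om) : measurable (cyl n w).
Proof.
have -> : cyl n w = \bigcap_(i in `I_n) coord_eq i%:Z (w i%:Z).
  by apply/seteqP; split => w' /= h i; exact: h.
by apply: bigcap_measurableType => i _; exact: measurable_coord_eq.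
Qed.

(** Negative [z] is allowed: composing with [shift (- m%:Z)] turns a function of the coordinates
    before time [m] into a function of the past. *)
Definition shift (z : int) (w : Om) : Om := fun n => w (n + z).

Lemma shiftD z z' w : shift z (shift z' w) = shift (z + z') w.
Proof. by apply/funext => n; rewrite /shift addrA. Qed.

Lemma shift0 w : shift 0 w = w.
Proof. by apply/funext => n; rewrite /shift addr0. Qed.

Lemma iter_Tshift j w : iter j (Tshift (A:=A)) w = shift j%:Z w.
Proof.
elim: j => [|j ih]; first by rewrite shift0.
rewrite iterS ih -[Tshift _]/(shift 1 _) shiftD; congr shift; lia.
Qed.

Lemma measurable_shift z : measurable_fun setT (shift z).
Proof.
apply: (@measurability _ _ Om Om setT (shift z) (cyl_gens (A:=A))) => //.
move=> _ [_ [j [a ->]] <-]; rewrite setTI.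
exact: (measurable_coord_eq (j + z) a).
Qed.

Lemma shift_invariant (R : realType) (mu : probability Om R) :
  (forall S, measurable S -> mu (Tshift (A:=A) @^-1` S) = mu S) ->
  forall z S, measurable S -> mu (shift z @^-1` S) = mu S.
Proof.
move=> mu_stat.
have pos j S : measurable S -> mu (shift (Posz j) @^-1` S) = mu S.
  move=> mS; elim: j => [|j ih].
    by congr (mu _); apply/seteqP; split => w /=; rewrite shift0.
  rewrite -ih -[RHS]mu_stat.
    congr (mu _); apply/seteqP; split => w /=;
      rewrite -[Tshift w]/(shift 1 w) shiftD -(_ : Posz j.+1 = Posz j + 1)//; lia.
  by rewrite -[X in measurable X]setTI; exact: measurable_shift.
move=> z S mS; have mzS : measurable (shift z @^-1` S).
  by rewrite -[X in measurable X]setTI; exact: measurable_shift.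
have [j zj] : exists j : nat, (z + j%:Z = 0) \/ (z = j%:Z).
  by exists `|z|%N; lia.
case: zj => [zj|->]; last exact: pos.
rewrite -(pos j _ mzS); congr (mu _); apply/seteqP; split => w /=;
  by rewrite shiftD zj shift0.
Qed.

End Coordinates.

(** * Functions of finitely many letters and predictions from them *)

Section FiniteAlphabet.
Context {A : pointedType} (Afin : finite_set [set: A]).
Local Notation Om := (Omega A).

Definition depends_before {U : Type} (j : nat) (h : Om -> U) : Prop :=
  forall w w' : Om, (forall i : nat, (i < j)%N -> w i%:Z = w' i%:Z) -> h w = h w'.

(** A representative of each cylinder of length [j]; the filler [point] outside the coordinates
    [0, ..., j - 1] is arbitrary. *)
Definition word (j : nat) (c : {ffun 'I_j -> fset_set [set: A]}) : Om :=
  fun z => if z is Posz i then oapp (fun i' => val (c i')) point (insub i)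
           else point.

(** The cylinders of words of length [j] partition the space, and [h] is constant on each.
    Finiteness of the alphabet makes the sum finite, whence measurability and boundedness of [h]. *)
Lemma depends_before_decomp {R : realType} j (h : Om -> R) (w : Om) :
  depends_before j h ->
  h w = \sum_(c : {ffun 'I_j -> fset_set [set: A]})
    h (word j c) * \1_(cyl j (word j c)) w.
Proof.
move=> hj.
have inK (x : A) : x \in fset_set [set: A] by rewrite (in_fset_set Afin) in_setT.
pose cw := [ffun i : 'I_j => [` inK (w i%:Z)]%fset].
have wcw (i : nat) : (i < j)%N -> word j cw i%:Z = w i%:Z.
  by move=> ij; rewrite /word insubT/= ffunE.
rewrite (bigD1 cw)//= big1 ?addr0.
  rewrite indicE mem_set ?mulr1//; first by apply: hj => i ij; rewrite wcw.
  by move=> i ij; rewrite wcw.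
move=> c ccw; rewrite indicE memNset ?mulr0// => wc.
move/eqP: ccw; apply; apply/ffunP => i; apply/val_inj; rewrite ffunE/=.
by rewrite (wc i (ltn_ord i)) /word valK.
Qed.

Lemma depends_beforeW {U : Type} i j (h : Om -> U) : (i <= j)%N ->
  depends_before i h -> depends_before j h.
Proof. by move=> ij hi w w' ww'; apply: hi => k ki; apply: ww'; exact: leq_trans ij. Qed.

Lemma bmfun_depends_before {R : realType} j (h : Om -> R) :
  depends_before j h -> bmfun h.
Proof.
move=> hj; rewrite (_ : h = fun w => \sum_(c : {ffun 'I_j -> fset_set [set: A]})
    h (word j c) * \1_(cyl j (word j c)) w); last first.
  by apply/funext => w; exact: depends_before_decomp.
apply: (bmfun_sum _ _ (fun c w => h (word j c) * \1_(cyl j (word j c)) w)) => c.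
by apply: bmfunM; [exact: bmfun_cst|(apply: bmfun_indic; exact: measurable_cyl)].
Qed.

Definition coord_ind {R : realType} (a : A) (j : nat) : Om -> R :=
  \1_(coord_eq j%:Z a).

Lemma bmfun_coord_ind {R : realType} a j : bmfun (coord_ind a j : Om -> R).
Proof. (apply: bmfun_indic; exact: measurable_coord_eq). Qed.

Lemma coord_ind01 {R : realType} a j w : 0 <= (coord_ind a j w : R) <= 1.
Proof. by rewrite /coord_ind indicE; case: (_ \in _); rewrite /= ?lexx ?ler01. Qed.

Lemma cyl_depends j : depends_before j (fun w : Om => cyl j w).
Proof.
move=> w w' ww'; apply/seteqP; split => v /= h i ij.
  by rewrite h// ww'.
by rewrite h// -ww'.
Qed.

Lemma cprob_depends {R : realType} (P : set Om -> \bar R) j a :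
  depends_before j (cprob P j a).
Proof. by move=> w w' /cyl_depends ww'; rewrite /cprob ww'. Qed.

Lemma coord_ind_depends {R : realType} a i j : (i < j)%N ->
  depends_before j (coord_ind a i : Om -> R).
Proof.
move=> ij w w' ww'; rewrite /coord_ind !indicE; congr (nat_of_bool _)%:R.
apply/idP/idP; rewrite !in_setE /coord_eq/= ww'//.
Qed.

Section Prediction.
Context {R : realType} (P : probability Om R) (a : A).

Lemma cprob01 j w : 0 <= cprob P j a w <= 1.
Proof.
rewrite /cprob; set C := cyl j w.
have mC : measurable C by exact: measurable_cyl.
have mCX : measurable (C `&` [set w' | w' j%:Z = a]).
  by apply: measurableI => //; exact: (measurable_coord_eq j%:Z a).
have le : fine (P (C `&` [set w' | w' j%:Z = a])) <= fine (P C).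
  rewrite fine_le ?fin_num_measure//.
  by apply: le_measure; rewrite ?inE//; exact: subIsetl.
have [P0|P0] := eqVneq (fine (P C)) 0; first by rewrite P0 invr0 mulr0 lexx ler01.
have Pp : 0 < fine (P C) by rewrite lt_def P0 fine_ge0.
by rewrite divr_ge0 ?fine_ge0//= ler_pdivrMr// mul1r.
Qed.

(** The convention [x / 0 = 0] does no harm: on a null cylinder both sides vanish. *)
Lemma cprob_mul j w :
  cprob P j a w * fine (P (cyl j w)) =
  fine (P (cyl j w `&` coord_eq j%:Z a)).
Proof.
rewrite /cprob -/(coord_eq j%:Z a); set C := cyl j w.
have mC : measurable C by exact: measurable_cyl.
have [P0|P0] := eqVneq (fine (P C)) 0; last by rewrite divfK.
have mCX : measurable (C `&` coord_eq j%:Z a).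
  by apply: measurableI => //; exact: measurable_coord_eq.
rewrite P0 mulr0; apply/eqP; rewrite eq_le fine_ge0//= -P0.
by rewrite fine_le ?fin_num_measure// le_measure ?inE.
Qed.

Lemma bmfun_cprob j : bmfun (cprob P j a).
Proof. exact: bmfun_depends_before (cprob_depends P j a). Qed.

(** On each cylinder [h] and [cprob P j a] are constant, and the two expectations cancel by
    [cprob_mul]. *)
Lemma cprob_orthogonal j (h : Om -> R) : depends_before j h ->
  Ex P (fun w => h w * (coord_ind a j w - cprob P j a w)) = 0.
Proof.
move=> hj.
pose F (c : {ffun 'I_j -> fset_set [set: A]}) w : R :=
  h (word j c) * (\1_(cyl j (word j c) `&` coord_eq j%:Z a) w -
    cprob P j a (word j c) * \1_(cyl j (word j c)) w).
have mc c : measurable (cyl j (word j c)) by exact: measurable_cyl.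
have mca c : measurable (cyl j (word j c) `&` coord_eq j%:Z a).
  (apply: measurableI => //; exact: measurable_coord_eq).
have b1 c : bmfun (\1_(cyl j (word j c)) : Om -> R) by exact: bmfun_indic.
have b2 c : bmfun (\1_(cyl j (word j c) `&` coord_eq j%:Z a) : Om -> R).
  exact: bmfun_indic.
have b3 c : bmfun (fun w => cprob P j a (word j c) * \1_(cyl j (word j c)) w).
  by apply: bmfunM => //; exact: bmfun_cst.
have b4 c : bmfun (fun w => \1_(cyl j (word j c) `&` coord_eq j%:Z a) w -
    cprob P j a (word j c) * \1_(cyl j (word j c)) w) by exact: bmfunB.
have bF c : bmfun (F c) by apply: bmfunM => //; exact: bmfun_cst.
have -> : (fun w => h w * (coord_ind a j w - cprob P j a w)) =
    fun w => \sum_c F c w.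
  apply/funext => w; rewrite (depends_before_decomp j h w hj) mulr_suml.
  apply: eq_bigr => c _; rewrite /F -mulrA; congr (_ * _).
  rewrite indicI [X in _ = X - _]/= !indicE; have [|_] := boolP (w \in cyl j (word j c)).
    rewrite inE => wc; rewrite !mul1r mulr1 /coord_ind indicE.
    by rewrite (cprob_depends P j a w (word j c) wc).
  by rewrite !mul0r mulr0 subr0.
rewrite Ex_sum// big1// => c _.
by rewrite ExZ// ExB// ExZ// !Ex_indic// cprob_mul subrr mulr0.
Qed.

(** For [i < j] the term of time [i] and the factor [g j] depend only on the coordinates before [j],
    so orthogonality is an instance of [cprob_orthogonal]. *)
Lemma slln_prediction (g : nat -> Om -> R) :
  (forall j, depends_before j (g j)) -> (forall j w, `|g j w| <= 1) ->
  {ae P, forall w, (fun N => N%:R^-1 *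
    \sum_(j < N) (g j w * (coord_ind a j w - cprob P j a w))) @ \oo --> (0 : R)}.
Proof.
move=> gd g1.
have bg j : bmfun (g j) := bmfun_depends_before _ _ (gd j).
apply: (slln_orthogonal P
  (fun j w => g j w * (coord_ind a j w - cprob P j a w)) 1).
- move=> j; apply: (bmfunM _ _ (bg j) _).1.
  exact: bmfunB (bmfun_coord_ind a j) (bmfun_cprob j).
- move=> j w; rewrite normrM mulr_ile1//.
  have /andP[x0 x1] := @coord_ind01 R a j w; have /andP[p0 p1] := cprob01 j w.
  by rewrite ler_norml; apply/andP; split; lra.
move=> i j ij.
rewrite -(cprob_orthogonal j
  (fun w => g i w * (coord_ind a i w - cprob P i a w) * g j w)).
  by congr (Ex P _); apply/funext => w; rewrite mulrA.
move=> w w' ww'.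
rewrite (depends_beforeW i j _ (ltnW ij) (gd i) w w')// (gd j w w')//.
rewrite (depends_beforeW i j _ (ltnW ij) (cprob_depends P i a) w w')//.
by rewrite (coord_ind_depends a i j ij w w').
Qed.

End Prediction.

End FiniteAlphabet.

(** * The completed sigma-algebra of the past *)

Section Past.
Context {A : pointedType} {R : realType}.
Local Notation Om := (Omega A).
Variable mu : probability Om R.
Hypothesis mu_stat :
  forall S, measurable S -> mu (Tshift (A:=A) @^-1` S) = mu S.

(** The window is [-n, ..., -1]. A set is a function into [Prop], so the same predicate serves for
    sets and for real functions. *)
Definition past_depends {U : Type} (n : nat) (h : Om -> U) : Prop :=
  forall w w' : Om,
    (forall i : nat, (i < n)%N -> w (- i.+1%:Z) = w' (- i.+1%:Z)) -> h w = h w'.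

Lemma past_dependsW {U : Type} m n (h : Om -> U) : (m <= n)%N ->
  past_depends m h -> past_depends n h.
Proof. by move=> mn hm w w' ww'; apply: hm => i im; apply: ww'; exact: leq_trans mn. Qed.

Lemma measurable_symdiff (X Y : set Om) :
  measurable X -> measurable Y -> measurable (symdiff X Y).
Proof. by move=> mX mY; apply: measurableU; exact: measurableD. Qed.

Lemma symdiffC (X Y : set Om) : symdiff X Y = symdiff Y X.
Proof. by rewrite /symdiff setUC. Qed.

Lemma le_symdiff (X Y Z V W U : set Om) :
  measurable X -> measurable Y -> measurable Z -> measurable V ->
  measurable W -> measurable U ->
  symdiff X Y `<=` symdiff Z V `|` symdiff W U ->
  (mu (symdiff X Y) <= mu (symdiff Z V) + mu (symdiff W U))%E.
Proof.
move=> mX mY mZ mV mW mU sub.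
have m1 := measurable_symdiff X Y mX mY.
have m2 := measurable_symdiff Z V mZ mV.
have m3 := measurable_symdiff W U mW mU.
apply: le_trans (measureU2 mu m2 m3).
by apply: le_measure; rewrite ?inE//; exact: measurableU.
Qed.

(* The [mu]-completion of the sigma-algebra of the past. Describing it through
   approximation yields the density of finite-depth functions for free, and it
   makes [alpha] measurable exactly rather than up to null sets. *)
Definition past_approx : set (set Om) := [set S | measurable S /\
  forall e : R, 0 < e -> exists n C, [/\ measurable C, past_depends n C &
    (mu (symdiff S C) <= e%:E)%E] ].

Lemma past_approx_measurable : past_approx `<=` measurable.
Proof. by move=> S []. Qed.

Lemma past_approx_depends n (S : set Om) :
  measurable S -> past_depends n S -> past_approx S.
Proof.
move=> mS dS; split => // e e0; exists n, S; split => //.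
by rewrite /symdiff setDv setU0 measure0 lee_fin ltW.
Qed.

(** The triangle inequality for [mu (symdiff _ _)]. It serves both for countable unions and for
    modification on null sets. *)
Lemma past_approx_trans (S : set Om) : measurable S ->
  (forall e : R, 0 < e ->
    exists2 S', past_approx S' & (mu (symdiff S S') <= e%:E)%E) ->
  past_approx S.
Proof.
move=> mS H; split => // e e0.
have e20 : 0 < e / 2 by lra.
have [S' [mS' HS'] SS'] := H _ e20.
have [n [C [mC dC S'C]]] := HS' _ e20.
exists n, C; split => //.
apply: (@le_trans _ _ (mu (symdiff S S') + mu (symdiff S' C))%E).
  apply: le_symdiff => // w [[h1 h2]|[h1 h2]]; have [h|h] := pselect (S' w);
    rewrite /symdiff /=; tauto.
by rewrite [in leRHS](splitr e) EFinD leeD.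
Qed.

Lemma past_approxC S : past_approx S -> past_approx (~` S).
Proof.
move=> [mS HS]; split => [|e e0]; first exact: measurableC.
have [n [C [mC dC SC]]] := HS e e0.
exists n, (~` C); split; first exact: measurableC.
  by move=> w w' /dC ww'; rewrite /setC/= ww'.
by rewrite /symdiff !setDE !setCK setUC (setIC (~` C)) (setIC (~` S)).
Qed.

Lemma past_approxU S S' :
  past_approx S -> past_approx S' -> past_approx (S `|` S').
Proof.
move=> [mS HS] [mS' HS']; split => [|e e0]; first exact: measurableU.
have e20 : 0 < e / 2 by lra.
have [n [C [mC dC SC]]] := HS _ e20; have [n' [C' [mC' dC' SC']]] := HS' _ e20.
exists (maxn n n'), (C `|` C'); split; first exact: measurableU.
  have h1 := past_dependsW _ _ _ (leq_maxl n n') dC.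
  have h2 := past_dependsW _ _ _ (leq_maxr n n') dC'.
  by move=> w w' ww'; rewrite /setU/= (h1 w w' ww') (h2 w w' ww').
apply: (@le_trans _ _ (mu (symdiff S C) + mu (symdiff S' C'))%E).
  by apply: le_symdiff => //; [exact: measurableU|exact: measurableU|];
    move=> w; rewrite /symdiff /=; tauto.
by rewrite [in leRHS](splitr e) EFinD leeD.
Qed.

Lemma past_approx0 : past_approx set0.
Proof. exact: (past_approx_depends 0%N). Qed.

(** A countable union is approximated by its finite subunions through continuity from below. *)
Lemma sigma_algebra_past_approx : sigma_algebra setT past_approx.
Proof.
split; first exact: past_approx0.
  by move=> S aS; rewrite setTD; exact: past_approxC.
move=> F aF; have mF n : measurable (F n) by have [] := aF n.
have mU : measurable (\bigcup_n F n) by exact: bigcup_measurable.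
apply: past_approx_trans => // e e0.
pose U n := \big[setU/set0]_(i < n.+1) F i.
have aU n : past_approx (U n).
  rewrite /U; elim: n => [|n ih]; first by rewrite big_ord1.
  by rewrite big_ord_recr; exact: past_approxU.
have mUn n : measurable (U n) by have [] := aU n.
have UE : \bigcup_n U n = \bigcup_n F n by exact: bigcup_bigsetU_bigcup.
have cv : mu (U n) @[n --> \oo] --> mu (\bigcup_n F n).
  rewrite -UE; apply: nondecreasing_cvg_mu => //; first by rewrite UE.
  move=> m n mn; apply/subsetPset; exact: subset_bigsetU.
have muU := fin_num_measure mu _ mU.
have [N HN] : exists N, (mu (\bigcup_n F n) - e%:E < mu (U N))%E.
  apply: contrapT => /forallNP h.
  have : (mu (\bigcup_n F n) <= mu (\bigcup_n F n) - e%:E)%E.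
    rewrite -[leLHS](cvg_lim _ cv)//; apply: lime_le; first by apply/cvg_ex; eexists; exact: cv.
    by apply: nearW => n; rewrite leNgt; exact/negP.
  by rewrite -(fineK muU) -EFinB lee_fin => hh; lra.
exists (U N) => //.
have sub : U N `<=` \bigcup_n F n by rewrite -UE; exact: bigcup_sup.
rewrite /symdiff (_ : U N `\` _ = set0) ?setU0; last by rewrite setD_eq0.
rewrite measureD//; last by rewrite ltey_eq muU.
have muUN := fin_num_measure mu _ (mUn N).
rewrite setIidr//.
have key (p q : \bar R) : p \is a fin_num -> q \is a fin_num ->
    (p - e%:E < q -> p - q <= e%:E)%E.
  case: p => // p; case: q => // q _ _; rewrite -!EFinB lte_fin lee_fin; lra.
exact: key muU muUN HN.
Qed.

Lemma past_approx_coord (i : int) a : i < 0 -> past_approx (coord_eq i a).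
Proof.
move=> i0; apply: (past_approx_depends `|i|%N); first exact: measurable_coord_eq.
move=> w w' ww'; rewrite /coord_eq/=.
have [k [ik iE]] : exists k : nat, (k < `|i|)%N /\ i = - k.+1%:Z.
  by exists `|i|.-1; lia.
by rewrite iE ww'.
Qed.

Lemma past_sigma_approx : past_sigma (A:=A) `<=` past_approx.
Proof.
apply: smallest_sub; first exact: sigma_algebra_past_approx.
move=> _ [j [a [j0 ->]]]; exact: past_approx_coord.
Qed.

(** The shift enlarges the window from [n] to [n + j], and stationarity preserves the approximation
    error. *)
Lemma past_approx_shift (j : nat) S :
  past_approx S -> past_approx (shift (- j%:Z) @^-1` S).
Proof.
move=> [mS HS].
have ms (X : set Om) : measurable X -> measurable (shift (- j%:Z) @^-1` X).
  by move=> mX; rewrite -[X in measurable X]setTI; exact: measurable_shift.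
split; first exact: ms.
move=> e e0; have [n [C [mC dC SC]]] := HS e e0.
exists (n + j)%N, (shift (- j%:Z) @^-1` C); split; first exact: ms.
  move=> w w' ww'; rewrite /preimage/=; apply: dC => i iN; rewrite /shift.
  rewrite (_ : - i.+1%:Z + - j%:Z = - (i + j).+1%:Z); last by lia.
  by apply: ww'; lia.
have -> : symdiff (shift (- j%:Z) @^-1` S) (shift (- j%:Z) @^-1` C) =
  shift (- j%:Z) @^-1` symdiff S C by [].
rewrite shift_invariant//; exact: measurable_symdiff.
Qed.

Local Notation past_fun f := (submeasurable_fun past_approx f).

Lemma past_fun_depends n (u : Om -> R) :
  measurable_fun setT u -> past_depends n u -> past_fun u.
Proof.
move=> mu' du _ Y mY; rewrite setTI sub_measurableE; last exact: sigma_algebra_past_approx.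
apply: (past_approx_depends n); first by rewrite -[X in measurable X]setTI; exact: mu'.
by move=> w w' /du ww'; rewrite /preimage/= ww'.
Qed.

Lemma past_fun_shift d (U : measurableType d) (f : Om -> U) (j : nat) :
  past_fun f -> past_fun (fun w => f (shift (- j%:Z) w)).
Proof.
move=> mf _ Y mY; rewrite setTI sub_measurableE; last exact: sigma_algebra_past_approx.
apply: (past_approx_shift j (f @^-1` Y)).
rewrite -[X in X _]sub_measurableE; last exact: sigma_algebra_past_approx.
by rewrite -[X in measurable X]setTI; exact: mf.
Qed.

End Past.

(** * Auxiliary facts on inversion, Cesaro means and null sets *)

Lemma measurable_invr (R : realType) : measurable_fun setT (@GRing.inv R).
Proof.
have -> : [set: R] = [set 0] `|` [set x | x != 0].
  by apply/seteqP; split => // x _ /=; case: (eqVneq x 0); [left|right].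
have mD : measurable [set x : R | x != 0].
  rewrite (_ : [set x | _] = ~` [set 0]); first exact: measurableC.
  by apply/seteqP; split => x /= /eqP.
apply/measurable_funU => //; split; first exact: measurable_fun_set1.
apply: open_continuous_measurable_fun.
  rewrite (_ : [set x | _] = ~` [set 0]); first exact/closed_openC/closed_eq.
  by apply/seteqP; split => x /= /eqP.
by move=> x; rewrite inE/= => x0; exact: inv_continuous.
Qed.

(** With [t = e / 4], the three summands of the bound each contribute at most [N * t ^ 2] to the sum
    of squares; then [z <= t + z ^ 2 / t] gives a mean of at most [t + 3 * t = e]. The summand
    [(j < n)] leaves room for finitely many initial times. *)
Lemma cesaro_of_squares (R : realType) (x : nat -> R) :
  (forall j, `|x j| <= 1) ->
  (forall e : R, 0 < e -> exists (y phi : nat -> R) (n : nat),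
    [/\ (fun N => N%:R^-1 * \sum_(j < N) y j) @ \oo --> (0 : R),
        (forall N, \sum_(j < N) phi j <= N%:R * e) &
        (forall j, x j ^+ 2 <= phi j + y j + (j < n)%N%:R)]) ->
  (fun N => N%:R^-1 * \sum_(j < N) `|x j|) @ \oo --> (0 : R).
Proof.
move=> x1 H; apply/cvgr0Pnorm_le => e e0.
pose t := e / 4; have t0 : 0 < t by rewrite divr_gt0.
have t20 : 0 < t ^+ 2 by rewrite exprn_gt0.
have [y [phi [n [cy sphi xle]]]] := H _ t20.
move/cvgr0Pnorm_le : cy => /(_ _ t20)[M1 _ HM1].
pose M2 := (Num.truncn (n%:R / t ^+ 2)).+1.
exists (maxn 1 (maxn M1 M2)) => // N /=; rewrite !geq_max => /and3P[N0 NM1 NM2].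
have N0' : 0 < N%:R :> R by rewrite ltr0n.
have hn : n%:R <= N%:R * t ^+ 2.
  rewrite -ler_pdivrMr//; apply: (@le_trans _ _ M2%:R); last by rewrite ler_nat.
  by rewrite ltW// truncnS_gt.
have hy := HM1 N NM1.
rewrite ger0_norm; last by rewrite mulr_ge0 ?invr_ge0 ?sumr_ge0// ltW.
rewrite ler_pdivrMl//.
have hy' : \sum_(j < N) y j <= N%:R * t ^+ 2.
  rewrite -ler_pdivrMl//; exact: le_trans (ler_norm _) hy.
have AM j : `|x j| <= t + t^-1 * x j ^+ 2.
  rewrite -(real_normK (num_real (x j))); set z := `|x j|.
  have z0 : 0 <= z by exact: normr_ge0.
  have -> : t + t^-1 * z ^+ 2 = z + t^-1 * ((t - z) ^+ 2 + t * z).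
    by field; rewrite gt_eqF.
  by rewrite lerDl mulr_ge0 ?invr_ge0 ?(ltW t0)// addr_ge0 ?sqr_ge0 ?mulr_ge0// ltW.
have sn : \sum_(j < N) ((j < n)%N%:R : R) <= n%:R.
  have [nN|Nn] := leqP n N; first by rewrite sum_ltn_ord.
  apply: (@le_trans _ _ (\sum_(j < N) (1 : R))).
    by apply: ler_sum => i _; case: (_ < _)%N.
  by rewrite sumr_const card_ord ler_nat ltnW.
have sx : \sum_(j < N) x j ^+ 2 <= 3 * (N%:R * t ^+ 2).
  apply: (@le_trans _ _ (\sum_(j < N) (phi j + y j + (j < n)%N%:R))).
    by apply: ler_sum => i _.
  rewrite !big_split/=; have := sphi N; lra.
apply: (@le_trans _ _ (\sum_(j < N) (t + t^-1 * x j ^+ 2))).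
  by apply: ler_sum => i _.
rewrite big_split/= sumr_const card_ord -mulr_sumr -[t *+ N]mulr_natl.
apply: (@le_trans _ _ (N%:R * t + t^-1 * (3 * (N%:R * t ^+ 2)))).
  by rewrite lerD2l ler_wpM2l// invr_ge0 ltW.
have -> : t^-1 * (3 * (N%:R * t ^+ 2)) = 3 * N%:R * t by field; rewrite gt_eqF.
by rewrite /t; lra.
Qed.

(** A [mu]-null set has fiber measures of integral zero, so almost every fiber gives it measure
    zero. *)
Lemma negligible_disintegration d d' (T : measurableType d)
  (U : measurableType d') (R : realType) (mu : probability T R)
  (lam : probability U R) (k : U -> probability T R)
  (k_meas : forall S, measurable S -> measurable_fun setT (fun u => k u S))
  (k_disint : forall S, measurable S -> mu S = (\int[lam]_u k u S)%E)
  (Q : T -> Prop) :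
  {ae mu, forall w, Q w} -> {ae lam, forall u, {ae k u, forall w, Q w}}.
Proof.
move=> [N [mN N0 NQ]].
have : ae_eq lam setT (fun u => k u N) (cst 0%E).
  apply/ae_eq_integral_abs => //; first exact: k_meas.
  by rewrite -[RHS]N0 k_disint//; apply: eq_integral => u _; rewrite gee0_abs.
apply: filterS => u /= /(_ Logic.I) kN; exists N; split => //.
Qed.

Lemma ae_all_mem d (T : measurableType d) (R : realType) (mu : probability T R)
  (I : eqType) (s : seq I) (Q : I -> T -> Prop) :
  (forall i, i \in s -> {ae mu, forall w, Q i w}) ->
  {ae mu, forall w, forall i, i \in s -> Q i w}.
Proof.
elim: s => [|i s ih] HQ; first exact: aeW.
have HQs : {ae mu, forall w, forall j, j \in s -> Q j w}.
  by apply: ih => j js; apply: HQ; rewrite in_cons js orbT.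
have Qi0 := HQ i (mem_head _ _).
apply: filterS2 Qi0 HQs => w Qi Qs j.
by rewrite in_cons => /predU1P[->//|]; exact: Qs.
Qed.

(** * Approximation by functions of finitely many past letters *)

Section PastApproximation.
Context {A : pointedType} {R : realType}.
Local Notation Om := (Omega A).
Variable mu : probability Om R.
Hypothesis mu_stat :
  forall S, measurable S -> mu (Tshift (A:=A) @^-1` S) = mu S.
Local Notation past_fun f := (submeasurable_fun (past_approx mu) f).

Lemma past_funW (f : Om -> R) : past_fun f -> measurable_fun setT f.
Proof.
exact: submeasurable_funW (sigma_algebra_past_approx mu) (past_approx_measurable mu) _ _ _.
Qed.

(** Each superlevel set of [r] is within [e / 2] of a set of finite depth. Replacing it by that set
    in [level_sum r M], where [1 / M <= e / 2], yields [u]; its depth is the largest of the [M]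
    depths. *)
Lemma past_fun_approx (r : Om -> R) (e : R) : 0 < e -> past_fun r ->
  (forall w, 0 <= r w <= 1) ->
  exists n (u : Om -> R), [/\ measurable_fun setT u, past_depends n u,
    (forall w, 0 <= u w <= 1) & Ex mu (fun w => `|u w - r w|) <= e].
Proof.
move=> e0 pr r01; have e20 : 0 < e / 2 by lra.
have br : bmfun r by apply: bmfun01 => //; exact: past_funW.
pose M := (Num.truncn (e / 2)^-1).+1.
have Me : M%:R^-1 <= e / 2 by rewrite invf_ple ?posrE// ltW// truncnS_gt.
have M0 : (0 < M)%N by [].
have M0' : 0 < M%:R :> R by rewrite ltr0n.
pose S (i : 'I_M) := [set w | i.+1%:R <= M%:R * r w].
have aS i : past_approx mu (S i).
  apply: (submeasurable_level _ (sigma_algebra_past_approx mu)).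
  exact: measurable_funM.
have mS i : measurable (S i) by have [] := aS i.
have /choice[m /choice[C HC]] : forall i : 'I_M, exists n C, [/\ measurable C,
    past_depends n C & (mu (symdiff (S i) C) <= (e / 2)%:E)%E].
  by move=> i; have [_] := aS i; apply.
pose n := (\max_(i < M) m i)%N.
pose u w : R := M%:R^-1 * \sum_(i < M) \1_(C i) w.
have bC i : bmfun (\1_(C i) : Om -> R) by apply: bmfun_indic; have [] := HC i.
have bu : bmfun u.
  apply: bmfunM; first exact: bmfun_cst.
  exact: (bmfun_sum _ _ (fun i => \1_(C i))).
have u01 w : 0 <= u w <= 1.
  rewrite /u mulr_ge0 ?invr_ge0 ?sumr_ge0//= ler_pdivrMl// mulr1.
  apply: (@le_trans _ _ (\sum_(i < M) 1)); last by rewrite sumr_const card_ord.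
  by apply: ler_sum => i _; rewrite indicE; case: (_ \in _).
exists n, u; split => //; first exact: bu.1.
  move=> w w' ww'; rewrite /u; congr (_ * _); apply: eq_bigr => i _.
  have [_ dC _] := HC i; rewrite !indicE; congr (nat_of_bool _)%:R.
  have := past_dependsW _ _ _ (leq_bigmax (F := m) i) dC w w' ww'.
  by move=> h; apply/idP/idP; rewrite !inE h.
have [bl lE] := Ex_level_sum_approx mu r M M0 br r01.
have msd i : measurable (symdiff (S i) (C i)).
  by apply: measurable_symdiff => //; have [] := HC i.
have bsd i : bmfun (\1_(symdiff (S i) (C i)) : Om -> R) by exact: bmfun_indic.
(* [v] dominates the distance between [u] and [level_sum r M]. *)
pose v w : R := M%:R^-1 * \sum_(i < M) \1_(symdiff (S i) (C i)) w.
have bsv : bmfun (fun w => \sum_(i < M) \1_(symdiff (S i) (C i)) w : R).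
  exact: (bmfun_sum _ _ (fun i => \1_(symdiff (S i) (C i)))).
have bv : bmfun v by apply: bmfunM => //; exact: bmfun_cst.
have Ev : Ex mu v <= e / 2.
  rewrite ExZ// (Ex_sum mu _ _ (fun i => \1_(symdiff (S i) (C i))))//.
  rewrite ler_pdivrMl//; apply: (@le_trans _ _ (\sum_(i < M) e / 2)).
    apply: ler_sum => i _; rewrite Ex_indic// -lee_fin fineK ?fin_num_measure//.
    by have [] := HC i.
  by rewrite sumr_const card_ord mulr_natl.
have bur : bmfun (fun w => `|u w - r w|) by apply/bmfun_norm; exact: bmfunB.
have brl : bmfun (fun w => `|r w - level_sum r M w|) by apply/bmfun_norm; exact: bmfunB.
apply: (@le_trans _ _ (Ex mu (fun w => `|r w - level_sum r M w| + v w))).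
  apply: le_Ex => //; first exact: bmfunD.
  move=> w; rewrite -(subrK (level_sum r M w) (u w)) -addrA addrC.
  apply: (le_trans (ler_normD _ _)); rewrite [in leLHS]distrC lerD2l.
  rewrite /u /level_sum /v -mulrBr normrM ger0_norm ?invr_ge0// ler_wpM2l ?invr_ge0//.
  rewrite -sumrB; apply: (le_trans (ler_norm_sum _ _ _)); apply: ler_sum => i _.
  rewrite -/(S i) !indicE.
  have [h1|h1] := boolP (w \in C i); have [h2|h2] := boolP (w \in S i);
    rewrite ?subrr ?normr0 ?ler0n// ?subr0 ?sub0r ?normrN ?normr1.
    by rewrite mem_set//; right; move: h1 h2; rewrite inE notin_setE.
  by rewrite mem_set//; left; move: h1 h2; rewrite inE notin_setE.
rewrite ExD//; lra.
Qed.

End PastApproximation.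

(** * Weak learning of the probability of a single letter *)

Section Learning.
Context {A : pointedType} (Afin : finite_set [set: A]) {R : realType}.
Local Notation Om := (Omega A).
Variable mu : probability Om R.
Hypothesis mu_stat :
  forall S, measurable S -> mu (Tshift (A:=A) @^-1` S) = mu S.
Local Notation past_fun f := (submeasurable_fun (past_approx mu) f).
Context {dT : measure_display} {Theta : measurableType dT}.
Variables (alpha : Om -> Theta) (k : Theta -> probability Om R).
Hypothesis past_alpha : past_fun alpha.
Hypothesis k_meas : forall S : set Om, measurable S ->
  measurable_fun [set: Theta] (fun th => k th S).

Lemma past_fun_depends_before m (h : Om -> R) : depends_before m h ->
  past_fun (fun w => h (shift (- m%:Z) w)).
Proof.
move=> hm; apply: (past_fun_depends mu m).
  exact: (measurableT_comp (bmfun_depends_before Afin m h hm).1 (measurable_shift _)).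
move=> w w' ww'; apply: hm => i im; rewrite /shift.
have -> : i%:Z + - m%:Z = - (m - i.+1).+1%:Z by lia.
by apply: ww'; lia.
Qed.

Lemma measurable_cprob j a (w : Om) :
  measurable_fun setT (fun th => cprob (k th) j a w).
Proof.
have mf (S : set Om) : measurable S -> measurable_fun setT (fun th => fine (k th S)).
  by move=> mS; apply: measurableT_comp => //; exact: k_meas.
apply: measurable_funM; first apply: mf.
  apply: measurableI; first exact: measurable_cyl.
  exact: (measurable_coord_eq j%:Z a).
apply: (measurableT_comp (measurable_invr R)); apply: mf; exact: measurable_cyl.
Qed.

(** The fiber is read off the point itself, so the fiber prediction becomes one function that can be
    integrated against [mu]; where [alpha w = th] it is [cprob (k th) j a w]. *)
Definition fiber_cprob j a (w : Om) : R := cprob (k (alpha w)) j a w.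

Lemma fiber_cprobE j a w : fiber_cprob j a w =
  \sum_(c : {ffun 'I_j -> fset_set [set: A]})
    cprob (k (alpha w)) j a (word j c) * \1_(cyl j (word j c)) w.
Proof.
exact: (depends_before_decomp Afin j _ w (cprob_depends (k (alpha w)) j a)).
Qed.

Lemma indic_cyl_depends j (w' : Om) :
  depends_before j (\1_(cyl j w') : Om -> R).
Proof.
move=> w v wv; rewrite !indicE; congr (nat_of_bool _)%:R.
by apply/idP/idP; rewrite !inE => h i ij; rewrite -?wv ?h// wv ?h.
Qed.

(** The sum over words separates the dependence through [alpha] from that through the letters. After
    the shift both belong to the past: the first by [past_fun_shift], the second because
    [j <= m]. *)
Lemma past_fun_fiber_cprob m j a : (j <= m)%N ->
  past_fun (fun w => fiber_cprob j a (shift (- m%:Z) w)).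
Proof.
move=> jm.
have -> : (fun w => fiber_cprob j a (shift (- m%:Z) w)) =
    (fun w => \sum_(c : {ffun 'I_j -> fset_set [set: A]})
    cprob (k (alpha (shift (- m%:Z) w))) j a (word j c) *
    \1_(cyl j (word j c)) (shift (- m%:Z) w)).
  by apply/funext => w; exact: fiber_cprobE.
rewrite /submeasurable_fun.
apply: (@measurable_sum _ (g_sigma_algebraType (past_approx mu)) R setT _ _
  (fun (c : {ffun 'I_j -> fset_set [set: A]}) w =>
  cprob (k (alpha (shift (- m%:Z) w))) j a (word j c) *
    \1_(cyl j (word j c)) (shift (- m%:Z) w))) => c.
apply: measurable_funM.
  apply: (measurableT_comp (measurable_cprob j a (word j c))).
  exact: past_fun_shift.
apply: past_fun_depends_before; apply: depends_beforeW jm _; exact: indic_cyl_depends.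
Qed.


Lemma past_fun_unshift m (h : Om -> R) :
  past_fun (fun w => h (shift (- m%:Z) w)) -> measurable_fun setT h.
Proof.
move=> ph; rewrite (_ : h = (fun w => h (shift (- m%:Z) w)) \o shift m%:Z); last first.
  by apply/funext => w; rewrite /= shiftD addNr shift0.
apply: measurableT_comp; last exact: measurable_shift.
exact: (past_funW _ _ ph).
Qed.

Lemma Ex_shift m (h : Om -> R) : bmfun h -> Ex mu (fun w => h (shift m w)) = Ex mu h.
Proof.
move=> bh; apply: (Ex_comp _ _ _ _ _ mu mu (shift m)) => //.
  exact: measurable_shift.
by move=> S mS; rewrite shift_invariant.
Qed.

Lemma fiber_cprob01 j a w : 0 <= fiber_cprob j a w <= 1.
Proof. exact: cprob01. Qed.

Section Target.
Variables (a : A) (r : Om -> R).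
Hypothesis past_r : past_fun r.
Hypothesis r01 : forall w, 0 <= r w <= 1.
Hypothesis r_orth : forall g : Om -> R, past_fun g ->
  (exists c, forall w, `|g w| <= c) ->
  Ex mu (fun w => g w * (coord_ind a 0 w - r w)) = 0.

(** Orthogonality of times [i < j] is checked after shifting by [- j]: the whole term of time [i]
    and the factor [F j] become a bounded function of the past, while [G j] becomes
    [coord_ind a 0 - r], so [r_orth] applies. *)
Lemma slln_past (s : nat -> Om -> R) :
  (forall j, depends_before j (s j)) -> (forall j w, 0 <= s j w <= 1) ->
  {ae mu, forall w, (fun N => N%:R^-1 * \sum_(j < N)
    ((s j w - fiber_cprob j a w) * (coord_ind a j w - r (shift j%:Z w))))
    @ \oo --> (0 : R)}.
Proof.
move=> sd s01; pose F j w := s j w - fiber_cprob j a w.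
pose G j w : R := coord_ind a j w - r (shift j%:Z w).
have F1 j w : `|F j w| <= 1.
  have /andP[? ?] := s01 j w; have /andP[? ?] := fiber_cprob01 j a w.
  by rewrite /F ler_norml; apply/andP; split; lra.
have G1 j w : `|G j w| <= 1.
  have /andP[? ?] := @coord_ind01 A R a j w; have /andP[? ?] := r01 (shift j%:Z w).
  by rewrite /G ler_norml; apply/andP; split; lra.
have pF i m : (i <= m)%N -> past_fun (fun w => F i (shift (- m%:Z) w)).
  move=> im; apply: measurable_funB; last exact: past_fun_fiber_cprob.
  by apply: past_fun_depends_before; exact: depends_beforeW im (sd i).
have pG i m : (i < m)%N -> past_fun (fun w => G i (shift (- m%:Z) w)).
  move=> im; apply: measurable_funB.
    by apply: past_fun_depends_before; exact: coord_ind_depends.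
  rewrite (_ : (fun w => _) = fun w => r (shift (- (m - i)%N%:Z) w)).
    exact: (past_fun_shift mu mu_stat _ _ _ (m - i)%N past_r).
  by apply/funext => w; rewrite shiftD; congr (r (shift _ w)); lia.
have bF i : bmfun (F i).
  by split; [exact: (past_fun_unshift _ _ (pF i i (leqnn i)))|exists 1].
have bG i : bmfun (G i).
  by split; [exact: (past_fun_unshift _ _ (pG i i.+1 (ltnSn i)))|exists 1].
apply: (slln_orthogonal mu (fun j w => F j w * G j w) 1).
- by move=> j; have [] := bmfunM _ _ (bF j) (bG j).
- by move=> j w; rewrite normrM mulr_ile1.
move=> i j ij.
pose g w := F i (shift (- j%:Z) w) * G i (shift (- j%:Z) w) * F j (shift (- j%:Z) w).
have pg : past_fun g.
  apply: measurable_funM; last exact: pF.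
  by apply: measurable_funM; [(apply: pF; exact: ltnW)|exact: pG].
have g1 w : `|g w| <= 1.
  by rewrite normrM mulr_ile1// normrM mulr_ile1.
have bg : bmfun g by split; [exact: (past_funW _ _ pg)|exists 1].
have <- : Ex mu (fun w => g w * (coord_ind a 0 w - r w)) = 0.
  by apply: r_orth => //; exists 1.
have bX : bmfun (fun w => coord_ind a 0 w - r w).
  apply: bmfunB; first exact: bmfun_coord_ind.
  by apply: bmfun01 => //; exact: (past_funW _ _ past_r).
rewrite -(Ex_shift j%:Z _ (bmfunM _ _ bg bX)).
congr (Ex mu _); apply/funext => w.
by rewrite /g !shiftD addNr !shift0 /G mulrA; congr (_ * (_ - _)).
Qed.

End Target.

(* The value before time [n] is irrelevant: it only affects [n] terms of a mean. *)
Definition delayed (n : nat) (u : Om -> R) (j : nat) (w : Om) : R :=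
  if (j < n)%N then 0 else u (shift j%:Z w).

Lemma delayed_depends n u j : past_depends n u ->
  depends_before j (delayed n u j).
Proof.
move=> du w w' ww'; rewrite /delayed; case: ltnP => // nj.
apply: du => i iN; rewrite /shift.
have -> : - i.+1%:Z + j%:Z = (j - i.+1)%N%:Z by lia.
by apply: ww'; lia.
Qed.

Lemma delayed01 n u j w : (forall w, 0 <= u w <= 1) -> 0 <= delayed n u j w <= 1.
Proof. by move=> u01; rewrite /delayed; case: ltnP; rewrite ?lexx ?ler01. Qed.

Variable lam : probability Theta R.
Hypothesis k_disint : forall S : set Om, measurable S ->
  mu S = (\int[lam]_th k th S)%E.

Lemma prediction_cesaro a :
  {ae lam, forall th, {ae k th, forall w, alpha w = th ->
    (fun N => N%:R^-1 * \sum_(j < N) `|cprob mu j a w - cprob (k th) j a w|)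
      @ \oo --> (0 : R)}}.
Proof.
have [r [pr r01 r_orth]] := cond_prob mu _ (sigma_algebra_past_approx mu)
  (past_approx_measurable mu) _ (measurable_coord_eq 0 a).
have inv0 m : 0 < m.+1%:R^-1 :> R by rewrite invr_gt0.
have /choice[n /choice[u Hu]] := fun m => past_fun_approx mu r m.+1%:R^-1 (inv0 m) pr r01.
pose s m := delayed (n m) (u m).
have sd m j : depends_before j (s m j).
  by apply: delayed_depends; have [] := Hu m.
have s01 m j w : 0 <= s m j w <= 1 by apply: delayed01; have [] := Hu m.
have p01 j w : 0 <= cprob mu j a w <= 1 by exact: cprob01.
pose phi m w := (u m w - r w) ^+ 2.
have br : bmfun r by apply: bmfun01 => //; exact: (past_funW _ _ pr).
have bu m : bmfun (u m) by have [mu' _ u01 _] := Hu m; exact: bmfun01.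
have bphi m : bmfun (phi m) by apply: bmfunM; exact: bmfunB.
(* The square is at most the absolute value, because [u m] and [r] lie in [0, 1]. *)
have Ephi m : Ex mu (phi m) <= m.+1%:R^-1.
  have [_ _ u01 Eu] := Hu m; apply: le_trans Eu; apply: le_Ex => //.
    by apply: bmfun_norm; exact: bmfunB.
  move=> w; rewrite /phi -real_normK ?num_real// expr2 ler_piMr//.
  have /andP[? ?] := u01 w; have /andP[? ?] := r01 w.
  by rewrite ler_norml; apply/andP; split; lra.
have H1 : {ae mu, forall w, forall m, (fun N => N%:R^-1 * \sum_(j < N)
    ((s m j w - fiber_cprob j a w) * (coord_ind a j w - r (shift j%:Z w))))
    @ \oo --> (0 : R)}.
  by apply/ae_foralln => m; exact: slln_past.
have H3 : {ae mu, forall w, forall m, (fun N => N%:R^-1 * \sum_(j < N)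
    ((s m j w - cprob mu j a w) * (coord_ind a j w - cprob mu j a w)))
    @ \oo --> (0 : R)}.
  apply/ae_foralln => m.
  apply: (slln_prediction Afin mu a (fun j w => s m j w - cprob mu j a w)).
    move=> j w w' ww'; rewrite (sd m j w w' ww').
    by rewrite (cprob_depends mu j a w w' ww').
  move=> j w; have /andP[? ?] := s01 m j w; have /andP[? ?] := p01 j w.
  by rewrite ler_norml; apply/andP; split; lra.
have H4 : {ae mu, forall w, forall e : R, 0 < e -> exists m, forall N,
    \sum_(j < N) phi m (shift j%:Z w) <= N%:R * e}.
  have H := ae_small_averages mu (Tshift (A:=A)) (measurable_shift 1) mu_stat
    phi bphi (fun m w => sqr_ge0 _) Ephi.
  apply: filterS H => w Hw e e0; have [m Hm] := Hw e e0; exists m => N.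
  by under eq_bigr do rewrite -iter_Tshift; exact: Hm.
have FM := ae_filter_ringOfSetsType mu.
(* The three statements proved [mu]-almost surely pass to almost every fiber. *)
have Hd := negligible_disintegration _ _ _ _ _ mu lam k k_meas k_disint _
  (@filterI _ _ FM _ _ H1 (@filterI _ _ FM _ _ H3 H4)).
apply: filterS Hd => th Hth.
(* Here the letters are compared with their predictions under [k th], so the strong law is applied
   under [k th] itself. *)
have H2 : {ae k th, forall w, (fun N => N%:R^-1 * \sum_(j < N)
    ((cprob mu j a w - cprob (k th) j a w) *
     (coord_ind a j w - cprob (k th) j a w))) @ \oo --> (0 : R)}.
  apply: (slln_prediction Afin (k th) a
    (fun j w => cprob mu j a w - cprob (k th) j a w)).
    move=> j w w' ww'; rewrite (cprob_depends mu j a w w' ww').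
    by rewrite (cprob_depends (k th) j a w w' ww').
  move=> j w; have /andP[? ?] := p01 j w.
  have /andP[? ?] := cprob01 (k th) a j w.
  by rewrite ler_norml; apply/andP; split; lra.
apply: filterS2 Hth H2 => w [h1 [h3 h4]] h2 aw.
apply: (@cesaro_of_squares R
  (fun j => cprob mu j a w - cprob (k th) j a w)) => [j|e e0].
  have /andP[? ?] := p01 j w; have /andP[? ?] := cprob01 (k th) a j w.
  by rewrite ler_norml; apply/andP; split; lra.
have [m Hm] := h4 e e0.
pose y1 j := (s m j w - fiber_cprob j a w) * (coord_ind a j w - r (shift j%:Z w)).
pose y2 j := (cprob mu j a w - cprob (k th) j a w) *
     (coord_ind a j w - cprob (k th) j a w).
pose y3 j := (s m j w - cprob mu j a w) * (coord_ind a j w - cprob mu j a w).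
exists (fun j => 2 * (y2 j + y3 j - y1 j)), (fun j => phi m (shift j%:Z w)), (n m).
split => //.
  rewrite (_ : (fun N : nat => _) = (fun N : nat => 2 * (
      N%:R^-1 * (\sum_(j < N) y2 j) + N%:R^-1 * (\sum_(j < N) y3 j)
      - N%:R^-1 * (\sum_(j < N) y1 j)))); last first.
    apply/funext => N; rewrite -mulr_sumr sumrB big_split/=; ring.
  have := cvgM (cvg_cst (2 : R)) (cvgB (cvgD h2 (h3 m)) (h1 m)).
  by rewrite !addr0 subr0 mulr0; apply.
move=> j; rewrite /y1 /y2 /y3 /fiber_cprob aw.
set p := cprob mu j a w; set q := cprob (k th) j a w.
set X := coord_ind a j w; set r' := r (shift j%:Z w).
(* The terms in [X] cancel, since [(p - q) + (s - p) = s - q], and the remaining gap is a sum of two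
   squares. *)
apply: (@le_trans _ _ ((s m j w - r') ^+ 2 +
    2 * ((p - q) * (X - q) + (s m j w - p) * (X - p) - (s m j w - q) * (X - r')))).
  rewrite -subr_ge0 (_ : _ - _ = (q - r') ^+ 2 + (s m j w - p) ^+ 2); last by ring.
  by rewrite addr_ge0// sqr_ge0.
(* From time [n m] on, [(s - r') ^ 2] is the shifted [phi m]. Before it [s = 0], and [r' ^ 2 <= 1]
   is absorbed by [(j < n m)]. *)
rewrite [leRHS]addrAC lerD// /s /delayed /phi; case: ltnP => jn; last by rewrite addr0.
rewrite ler_wpDl ?sqr_ge0//= sub0r sqrrN expr_le1//; have /andP[? ?] := r01 (shift j%:Z w) => //.
Qed.

End Learning.

(** * From single letters to the distance of predictions *)

Lemma standard_borel_set1 (R : realType) (d : measure_display)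
  (Th : measurableType d) (th : Th) :
  standard_borel R Th -> measurable [set th].
Proof.
move=> [f [finj [mf _]]].
rewrite (_ : [set th] = [set: Th] `&` f @^-1` [set f th]); first exact: mf.
by rewrite setTI; apply/seteqP; split => x /=; [move=> ->|move/finj].
Qed.

Lemma cesaro_sum0 (R : realType) (I : eqType) (s : seq I) (x : I -> nat -> R) :
  (forall i, i \in s ->
    (fun N => N%:R^-1 * \sum_(j < N) x i j) @ \oo --> (0 : R)) ->
  (fun N => N%:R^-1 * \sum_(j < N) \sum_(i <- s) x i j) @ \oo --> (0 : R).
Proof.
elim: s => [|i s ih] xs.
  rewrite (_ : (fun _ => _) = fun=> 0); first exact: cvg_cst.
  by apply/funext => N; rewrite big1 ?mulr0// => j _; rewrite big_nil.
rewrite (_ : (fun _ => _) = fun N => N%:R^-1 * (\sum_(j < N) x i j) +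
    N%:R^-1 * \sum_(j < N) \sum_(i <- s) x i j); last first.
  apply/funext => N; rewrite -mulrDr -big_split/=; congr (_ * _).
  by apply: eq_bigr => j _; rewrite big_cons.
rewrite -[X in _ --> X]addr0; apply: cvgD; first by apply: xs; rewrite mem_head.
by apply: ih => l ls; apply: xs; rewrite in_cons ls orbT.
Qed.

(** Bounding the maximum by the sum lets the letters be treated one at a time. *)
Lemma dist_diff_le_sum (A : pointedType) (R : realType)
  (P Q : set (Omega A) -> \bar R) n w :
  0 <= dist_diff P Q n w <=
  \sum_(a <- (fset_set [set: A] : seq A)) `|cprob P n a w - cprob Q n a w|.
Proof.
rewrite /dist_diff; elim: (fset_set _ : seq A) => [|a s /andP[ih0 ih1]].
  by rewrite !big_nil lexx.
rewrite !big_cons le_max ih0 orbT/= ge_max lerDl (le_trans ih0 ih1)/=.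
by rewrite (le_trans ih1)// lerDr.
Qed.

Theorem theorem2 (R : realType) (A : pointedType)
  (Afin : finite_set [set: A])
  (mu : probability (Omega A) R)
  (mu_stat : forall S : set (Omega A), measurable S ->
     mu (Tshift (A:=A) @^-1` S) = mu S)
  (D : set (set (Omega A)))
  (D_sigma : sigma_algebra setT D)
  (D_borel : D `<=` measurable)
  (D_shift : forall S : set (Omega A), measurable S ->
     (D S <-> D (Tshift (A:=A) @` S)))
  (D_past : D `<=` past_sigma (A:=A))
  (dT : measure_display) (Theta : measurableType dT)
  (Theta_std : standard_borel R Theta)
  (alpha : Omega A -> Theta) (alpha_meas : measurable_fun setT alpha)
  (lam : probability Theta R)
  (lam_push : forall B : set Theta, measurable B -> lam B = mu (alpha @^-1` B))
  (D_gen1 : forall S, D S -> exists B : set Theta,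
     measurable B /\ mu (symdiff S (alpha @^-1` B)) = 0%E)
  (D_gen2 : forall B : set Theta, measurable B -> exists S,
     D S /\ mu (symdiff S (alpha @^-1` B)) = 0%E)
  (k : Theta -> probability (Omega A) R)
  (k_meas : forall S : set (Omega A), measurable S ->
     measurable_fun [set: Theta] (fun th => k th S))
  (k_fiber : forall th, k th (alpha @^-1` [set th]) = 1%E)
  (k_disint : forall S : set (Omega A), measurable S ->
     mu S = (\int[lam]_th k th S)%E) :
  {ae lam, forall th,
    {ae k th, forall w : Omega A,
      strong_cesaro0 (fun n => dist_diff mu (k th) n w)}}.
Proof.
have past_alpha : submeasurable_fun (past_approx mu) alpha.
  move=> _ B mB; rewrite setTI sub_measurableE; last exact: sigma_algebra_past_approx.
  have maB : measurable (alpha @^-1` B).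
    by rewrite -[X in measurable X]setTI; exact: alpha_meas.
  have [S [DS SB]] := D_gen2 B mB.
  apply: past_approx_trans => // e e0; exists S.
    by apply: past_sigma_approx; exact: D_past.
  by rewrite symdiffC SB lee_fin ltW.
pose C th a w := alpha w = th ->
  (fun N : nat => N%:R^-1 * \sum_(j < N) `|cprob mu j a w - cprob (k th) j a w|)
    @ \oo --> (0 : R).
have HC a : {ae lam, forall th, {ae k th, forall w, C th a w}}.
  exact: (prediction_cesaro Afin mu mu_stat alpha k past_alpha k_meas lam k_disint).
have HA := ae_all_mem _ _ _ lam _ (fset_set [set: A] : seq A)
  (fun a th => {ae k th, forall w, C th a w}) (fun a _ => HC a).
apply: filterS HA => th Hth.
have fib : {ae k th, forall w, alpha w = th}.
  (* Points of a standard space are measurable, which makes the fiber an event with a null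
     complement under [k th]. *)
  have mth : measurable (alpha @^-1` [set th]).
    rewrite -[X in measurable X]setTI; apply: alpha_meas => //.
    exact: standard_borel_set1 Theta_std.
  exists (~` (alpha @^-1` [set th])); split => //; first exact: measurableC.
  by rewrite probability_setC// k_fiber subee.
have Hall : {ae k th, forall w, forall a, a \in (fset_set [set: A] : seq A) -> C th a w}.
  exact: ae_all_mem.
apply: filterS2 fib Hall => w aw Hw; rewrite /strong_cesaro0.
pose x a j := `|cprob mu j a w - cprob (k th) j a w|.
(* The Cesaro means of the distance lie between 0 and the finite sum over letters of the
   single-letter means. *)
apply: (@squeeze_cvgr _ _ _ _ (fun=> 0)
  (fun N => N%:R^-1 * \sum_(j < N) \sum_(a <- (fset_set [set: A] : seq A)) x a j)).
- apply: nearW => N; rewrite mulr_ge0 ?invr_ge0 ?sumr_ge0//= ler_wpM2l ?invr_ge0//.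
  apply: ler_sum => j _; have /andP[d0 d1] := dist_diff_le_sum A R mu (k th) j w.
  by rewrite subr0 ger0_norm.
- exact: cvg_cst.
- by apply: cesaro_sum0 => a sa; exact: Hw.
Qed.
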